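(* Let $s \geq 1$ and let $\emptyset \neq K \subset \mathbb{R}^{2}$ be a bounded $\mathcal{H}^{s}$-measurable $s$-Ahlfors-David-regular set. Then $\overline{\dim}_{\mathrm{B}} D(K) = 1$, where $D(K) = \{|x - y| : x,y \in K\} \subset \mathbb{R}$ is the distance set of $K$.
   Context: Ahlfors-David regularity. Let $C \geq 1$. A Borel measure $\mu$ on $\mathbb{R}^{d}$ is $(s,C)$-Ahlfors-David regular if $r^{s}/C \leq \mu(B(x,r)) \leq C r^{s}$ for all $x \in \operatorname{spt} \mu$ and $0 < r \leq \operatorname{diam}(\operatorname{spt} \mu)$. An $\mathcal{H}^{s}$-measurable set $K \subset \mathbb{R}^{d}$ is $(s,C)$-Ahlfors-David regular if $0 < \mathcal{H}^{s}(K) < \infty$ and the restriction $\mathcal{H}^{s}|_{K}$ of $s$-dimensional Hausdorff measure to $K$ is an $(s,C)$-Ahlfors-David regular measure. $K$ is $s$-Ahlfors-David regular if it is $(s,C)$-Ahlfors-David regular for some $C \geq 1$. Upper box dimension. For bounded $B \subset \mathbb{R}^{d}$, let $N(B,\delta)$ be the least number of $\delta$-balls needed to cover $B$, and let $\overline{\dim}_{\mathrm{B}} B := \limsup_{\delta \to 0} \frac{\log N(B,\delta)}{-\log \delta}$. *)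

(* Defs.v *)
From HB Require Import structures.
From mathcomp Require Import all_boot all_order all_algebra.
From mathcomp Require Import ring lra.
From mathcomp Require Import all_classical all_reals all_analysis.
Set Implicit Arguments.
Unset Strict Implicit.
Unset Printing Implicit Defensive.
Import Order.TTheory GRing.Theory Num.Theory.
Import numFieldNormedType.Exports.
Local Open Scope classical_set_scope.
Local Open Scope ring_scope.

(* The canonical norm of 'rV[R]_d is the sup norm, hence the alias below, which
   carries the Euclidean norm and the metric and topology it induces. *)
Definition euclidean (R : realType) (d : nat) : Type := 'rV[R]_d.

HB.instance Definition _ (R : realType) (d : nat) :=
  GRing.Lmodule.copy (euclidean R d) 'rV[R]_d.

Definition enorm (R : realType) (d : nat) (x : euclidean R d) : R :=
  Num.sqrt (\sum_(i < d) (x : 'rV[R]_d) 0 i ^+ 2).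

Lemma enorm_sqr (R : realType) (d : nat) (x : euclidean R d) :
  enorm x ^+ 2 = \sum_(i < d) (x : 'rV[R]_d) 0 i ^+ 2.
Proof. by rewrite sqr_sqrtr// sumr_ge0// => i _; exact: sqr_ge0. Qed.

Lemma cauchy_schwarz (R : realType) (d : nat) (x y : euclidean R d) :
  \sum_(i < d) (x : 'rV[R]_d) 0 i * (y : 'rV[R]_d) 0 i <= enorm x * enorm y.
Proof.
move sE : (X in X <= _) => s.
have key : 0 <= \sum_(i < d) (enorm y ^+ 2 * (x : 'rV[R]_d) 0 i
                              - s * (y : 'rV[R]_d) 0 i) ^+ 2.
  by apply: sumr_ge0 => i _; exact: sqr_ge0.
have E : \sum_(i < d) (enorm y ^+ 2 * (x : 'rV[R]_d) 0 i
                       - s * (y : 'rV[R]_d) 0 i) ^+ 2 =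
    enorm y ^+ 2 * ((enorm x * enorm y) ^+ 2 - s ^+ 2).
  transitivity (enorm y ^+ 4 * \sum_(i < d) (x : 'rV[R]_d) 0 i ^+ 2
    - 2 * enorm y ^+ 2 * s *
        \sum_(i < d) (x : 'rV[R]_d) 0 i * (y : 'rV[R]_d) 0 i
    + s ^+ 2 * \sum_(i < d) (y : 'rV[R]_d) 0 i ^+ 2).
    rewrite !mulr_sumr -sumrN -!big_split/=.
    by apply: eq_bigr => i _; ring.
  by rewrite -!enorm_sqr sE; ring.
have y0 : 0 <= enorm y by exact: sqrtr_ge0.
have x0 : 0 <= enorm x by exact: sqrtr_ge0.
have [yz|yN0] := eqVneq (enorm y) 0.
  have yi i : (y : 'rV[R]_d) 0 i = 0.
    apply/eqP; rewrite -sqrf_eq0.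
    have := enorm_sqr y; rewrite yz expr0n/= => /esym/eqP.
    by rewrite psumr_eq0 => [/allP/(_ i)|j _]; rewrite ?sqr_ge0//
      mem_index_enum => /(_ isT).
  by rewrite yz mulr0 -sE big1// => i _; rewrite yi mulr0.
move: key; rewrite E pmulr_rge0 ?exprn_gt0// ?lt_neqAle 1?eq_sym ?yN0// subr_ge0.
move=> h; rewrite (le_trans (ler_norm s))//.
by rewrite -(@ler_pXn2r _ 2)// ?nnegrE ?mulr_ge0// real_normK ?num_real.
Qed.

Lemma ler_enormD (R : realType) (d : nat) (x y : euclidean R d) :
  enorm (x + y) <= enorm x + enorm y.
Proof.
have x0 : 0 <= enorm x by exact: sqrtr_ge0.
have y0 : 0 <= enorm y by exact: sqrtr_ge0.
rewrite -(@ler_pXn2r _ 2)// ?nnegrE ?addr_ge0 ?sqrtr_ge0//.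
rewrite enorm_sqr sqrrD !enorm_sqr.
under eq_bigr do rewrite mxE sqrrD.
rewrite !big_split/= lerD2r lerD2l -mulr2n lerMn2r/=.
exact: cauchy_schwarz.
Qed.

Lemma enormZ (R : realType) (d : nat) (l : R) (x : euclidean R d) :
  enorm (l *: x) = `|l| * enorm x.
Proof.
rewrite /enorm; under eq_bigr do rewrite mxE exprMn.
by rewrite -mulr_sumr sqrtrM ?sqr_ge0// sqrtr_sqr.
Qed.

Lemma enorm_eq0 (R : realType) (d : nat) (x : euclidean R d) :
  enorm x = 0 -> x = 0.
Proof.
move=> x0; apply/rowP => i; rewrite mxE; apply/eqP; rewrite -sqrf_eq0.
have := enorm_sqr x; rewrite x0 expr0n/= => /esym/eqP.
by rewrite psumr_eq0 => [/allP/(_ i)|j _]; rewrite ?sqr_ge0//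
  mem_index_enum => /(_ isT).
Qed.

HB.instance Definition _ (R : realType) (d : nat) :=
  Lmodule_isNormed.Build R (euclidean R d)
    (@ler_enormD R d) (@enormZ R d) (@enorm_eq0 R d).

Section metric_geometry.
Context {R : realType} {V : normedModType R}.
Local Open Scope ereal_scope.

(* [maxe 0] only matters for the empty set, whose diameter is 0. *)
Definition diam (A : set V) : \bar R :=
  maxe 0 (ereal_sup [set `|x - y|%:E | x in A & y in A]).

(* Only nonempty sets of the cover contribute, so that finite covers are allowed
   also when [s = 0], where [0 `^ 0 = 1]. *)
Definition hausdorff_premeasure (s delta : R) (A : set V) : \bar R :=
  ereal_inf [set \sum_(i <oo | U i != set0) (diam (U i) `^ s) |
    U in [set U : (set V)^nat | A `<=` \bigcup_i U i /\
                                forall i, diam (U i) <= delta%:E]].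

(* Without the normalizing constant that some authors include. *)
Definition hausdorff_measure (s : R) (A : set V) : \bar R :=
  ereal_sup [set hausdorff_premeasure s delta A |
    delta in [set delta : R | (0 < delta)%R]].

Definition restriction (mu : set V -> \bar R) (K : set V) : set V -> \bar R :=
  fun A => mu (A `&` K).

Definition spt (mu : set V -> \bar R) : set V :=
  [set x | forall U : set V, open U -> U x -> 0 < mu U].

(* [mu] is a total set function because Hausdorff measure is an outer measure;
   only its values on open sets and on closed balls are used. *)
Definition AD_regular_measure (s C : R) (mu : set V -> \bar R) : Prop :=
  forall (x : V) (r : R), spt mu x -> (0 < r)%R -> r%:E <= diam (spt mu) ->
    (r `^ s / C)%:E <= mu (closed_ball x r) /\
    mu (closed_ball x r) <= (C * r `^ s)%:E.

Definition AD_regular_with (s C : R) (K : set V) : Prop :=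
  [/\ (hausdorff_measure s).-caratheodory K,
      0 < hausdorff_measure s K, hausdorff_measure s K < +oo &
      AD_regular_measure s C (restriction (hausdorff_measure s) K)].

Definition AD_regular (s : R) (K : set V) : Prop :=
  exists2 C : R, (1 <= C)%R & AD_regular_with s C K.

Definition ball_coverable (B : set V) (delta : R) (n : nat) : Prop :=
  exists c : 'I_n -> V, B `<=` \bigcup_i closed_ball (c i) delta.

(* The value 0 is junk, for [B] not coverable by finitely many balls. *)
Definition covering_number (B : set V) (delta : R) : nat :=
  xget 0%N [set n | ball_coverable B delta n /\
                    forall m, ball_coverable B delta m -> (n <= m)%N].

Definition upper_box_dim (B : set V) : \bar R :=
  limf_esup
    (fun delta : R => (ln (covering_number B delta)%:R / (- ln delta))%:E) 0^'+.

Definition distance_set (K : set V) : set R :=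
  [set `|x - y|%R | x in K & y in K].

End metric_geometry.

(* Main.v *)
Require Import Defs.
From HB Require Import structures.
From mathcomp Require Import all_boot all_order all_algebra.
From mathcomp Require Import ring lra zify.
From mathcomp Require Import all_classical all_reals all_analysis.
Set Implicit Arguments.
Unset Strict Implicit.
Unset Printing Implicit Defensive.
Import Order.TTheory GRing.Theory Num.Theory.
Import numFieldNormedType.Exports.
Local Open Scope classical_set_scope.
Local Open Scope ring_scope.

(** The distance set lies in a bounded interval, so only the lower bound of its
    dimension is at stake.

    Let [E] be the set of the points of [K] that lie in the support of the
    restricted Hausdorff measure.  Comparing measures of balls, regularity with
    [s >= 1] yields the combinatorial property [evenly_spread]: a ball of radius
    [r] around a point of [E] contains a finite subset of [E] of which a
    fraction at most [A * u * rho] is within [u * rho * r] of any given one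
    ([AD_regular_evenly_spread]).  The Hausdorff measure enters only there.  The
    rest is a dichotomy on the slopes [i / 2 ^ m] between 0 and 1, for a large
    fixed [m].

    Suppose first that, in some ball around a point of [E], no two points of [E]
    span a slope close to one of them.  There [E] is a Lipschitz graph over a
    line, and since it is evenly spread, its projection [t] to that line meets at
    least a fixed proportion of the dyadic cells at every level.  The proportion
    of the cells that it meets does not increase with the level, so it
    almost stabilizes, and from then on one cell of that level is almost full
    at any given finer level ([dense_cell]).  Let [a] be a point of [E] near one
    end of this cell.  The distance to [a] starts from 0, reaches a fixed
    proportion of the length of the cell, and is Lipschitz in [t], so it can
    only skip values over the few gaps of the cell: the distances to [a]
    alone meet a fixed proportion of an interval of fixed length, at the scale
    of that finer level ([graph_distance_cells]).

    Otherwise every ball around a point of [E] contains, for each [i], two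
    points of [E] spanning a slope close to [i / 2 ^ m].  Take one of the two as
    a pin: on a small ball around the other, the distance to the pin is
    almost a linear form whose direction has that slope, and it stays so on
    smaller balls.  Treating the slopes one after the other gives a single ball
    on which all of these forms occur ([exists_common_pins]).  A vector [d] is
    almost orthogonal to few of the directions; on average over the pins,
    the distances therefore separate the evenly spread points of a ball of
    radius [r] into groups of size [O(m / 2 ^ m)] times their number.  By
    concavity, the mean over the pins of the logarithm of the number of
    distances seen at a given scale grows by at least [m ln 2 - O(ln m)] each
    time the scale is divided by [2 ^ m] ([sum_ln_cells_ge]); the forms being
    the same at all scales and places of the ball, these gains add up.  So at
    each such scale some pin gives dimension [1 - O(ln m / m)], and [m] is
    arbitrary. *)

(** * Hausdorff measure as an outer measure *)

Section hausdorff.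
Context {R : realType} {V : normedModType R}.
Local Open Scope ereal_scope.
Implicit Types (A B K : set V) (U : (set V)^nat) (s delta : R).

(** The value [+oo] on sets that are too large turns the restriction on the
    covers into part of the summand, so that the premeasure becomes an outer
    measure induced by a set function. *)
Definition gauge s delta A : \bar R :=
  if A == set0 then 0 else if diam A <= delta%:E then diam A `^ s else +oo.

Lemma gauge0 s delta : gauge s delta set0 = 0.
Proof. by rewrite /gauge eqxx. Qed.

Lemma gauge_ge0 s delta A : 0 <= gauge s delta A.
Proof. by rewrite /gauge; case: ifP => // _; case: ifP => // _; rewrite poweR_ge0. Qed.

Lemma diam0 : diam (set0 : set V) = 0.
Proof.
rewrite /diam (_ : [set _ | _ in _ & _ in _] = set0) ?ereal_sup0 ?maxeNy//.
by rewrite -subset0 => z [x].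
Qed.

Lemma diam1 (p : V) : diam [set p] = 0.
Proof.
rewrite /diam (_ : [set _ | _ in _ & _ in _] = [set 0]) ?ereal_sup1 ?maxxx//.
rewrite eqEsubset; split => [_ [x -> [y -> <-]]|_ ->]; first by rewrite subrr normr0.
by exists p => //; exists p => //; rewrite subrr normr0.
Qed.

(* the sigma-algebra in which every set is measurable *)
Let coverable := g_sigma_algebraType [set: set V].

Lemma hausdorff_premeasure_mu_ext s delta : (0 < delta)%R ->
  hausdorff_premeasure s delta =
  @mu_ext _ coverable R (gauge s delta : set coverable -> \bar R).
Proof.
move=> d0; apply/funext => A; apply/eqP; rewrite eq_le; apply/andP; split.
  apply: le_ereal_inf_tmp => _ [U [_ AU] <-].
  have [small|/existsNP[i /existsNP big]] :=
      pselect (forall i, U i !=set0 -> diam (U i) <= delta%:E).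
    apply: ereal_inf_lbound; exists U.
      split => // i; have [->|/set0P/small//] := eqVneq (U i) set0.
      by rewrite diam0 lee_fin ltW.
    rewrite eseries_mkcond; apply: eq_eseriesr => i _; rewrite /gauge.
    by case: eqVneq => //= /set0P/small ->.
  case: big => U0 big; rewrite (_ : \sum_(_ <oo) _ = +oo) ?leey//.
  apply: (@eseries_pinfty _ _ _ i) => //.
    by move=> n _; rewrite -ltNye (lt_le_trans _ (gauge_ge0 _ _ _)).
  by rewrite /gauge; case: eqVneq U0 => [->[]//|_ _]; rewrite (negbTE (introN idP big)).
apply: le_ereal_inf_tmp => _ [U [AU Ud] <-]; apply: ereal_inf_lbound; exists U.
  by split => // i; exact: sub_sigma_algebra.
rewrite [RHS]eseries_mkcond; apply: eq_eseriesr => i _; rewrite /gauge Ud.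
by case: eqVneq.
Qed.

Lemma hausdorff_premeasure_ge0 s delta A : 0 <= hausdorff_premeasure s delta A.
Proof.
apply: le_ereal_inf_tmp => _ [U _ <-]; apply: nneseries_ge0 => i _ _.
exact: poweR_ge0.
Qed.

Lemma le_hausdorff_premeasure_measure s delta A : (0 < delta)%R ->
  hausdorff_premeasure s delta A <= hausdorff_measure s A.
Proof. by move=> d0; apply: ereal_sup_ubound; exists delta. Qed.

Lemma hausdorff_measure_le s A M :
  (forall delta, (0 < delta)%R -> hausdorff_premeasure s delta A <= M) ->
  hausdorff_measure s A <= M.
Proof. by move=> h; apply: ge_ereal_sup => _ [delta d0 <-]; exact: h. Qed.

Let hausdorff_measure_ge0 s A : 0 <= hausdorff_measure s A.
Proof.
apply: le_trans (le_hausdorff_premeasure_measure s A ltr01).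
exact: hausdorff_premeasure_ge0.
Qed.

Let hausdorff_measure0 s : hausdorff_measure s (set0 : set V) = 0.
Proof.
apply/eqP; rewrite eq_le hausdorff_measure_ge0 andbT.
apply: hausdorff_measure_le => d d0; rewrite hausdorff_premeasure_mu_ext//.
by rewrite (@mu_ext0 _ coverable R _ (gauge0 s d) (gauge_ge0 s d)).
Qed.

Let le_hausdorff_measure s :
  {homo @hausdorff_measure R V s : A B / A `<=` B >-> A <= B}.
Proof.
move=> A B AB; apply: hausdorff_measure_le => d d0.
apply: le_trans (le_hausdorff_premeasure_measure s B d0).
by rewrite hausdorff_premeasure_mu_ext// le_mu_ext.
Qed.

Let hausdorff_measure_sigma_subadditive s :
  sigma_subadditive (@hausdorff_measure R V s).
Proof.
move=> A; apply: hausdorff_measure_le => d d0.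
rewrite hausdorff_premeasure_mu_ext//.
apply: le_trans (@mu_ext_sigma_subadditive _ coverable R _ (gauge_ge0 s d) _) _.
apply: lee_nneseries => [i _ _|i _]; first exact: (@mu_ext_ge0 _ coverable R _ (gauge_ge0 s d)).
by rewrite -hausdorff_premeasure_mu_ext// le_hausdorff_premeasure_measure.
Qed.

HB.instance Definition _ s := isOuterMeasure.Build R V (@hausdorff_measure R V s)
  (hausdorff_measure0 s) (hausdorff_measure_ge0 s) (@le_hausdorff_measure s)
  (@hausdorff_measure_sigma_subadditive s).

Lemma hausdorff_measure1 s (p : V) : (0 < s)%R -> hausdorff_measure s [set p] = 0.
Proof.
move=> s0; apply/eqP; rewrite eq_le hausdorff_measure_ge0 andbT.
apply: hausdorff_measure_le => d d0; apply: ereal_inf_lbound.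
exists (fun i => if i == 0%N then [set p] else set0).
  split; first by move=> x px; exists 0%N.
  by move=> i; case: ifP; rewrite ?diam1 ?diam0 lee_fin ltW.
apply: eseries0 => i _ _; case: ifP; rewrite ?diam1 ?diam0 poweR0r//;
  by rewrite gt_eqF.
Qed.

(** A cover by sets of diameter less than [g] splits into the sets that meet
    [A] and those that meet [B]. *)
Lemma hausdorff_measureU_separated s A B (g : R) : (0 < g)%R ->
  (forall x y, A x -> B y -> (g <= `|x - y|)%R) ->
  hausdorff_measure s A + hausdorff_measure s B <= hausdorff_measure s (A `|` B).
Proof.
move=> g0 gAB.
have small (d : R) : (0 < d)%R -> (d < g)%R ->
    hausdorff_premeasure s d A + hausdorff_premeasure s d B <=
    hausdorff_premeasure s d (A `|` B).
  move=> d0 dg; apply: le_ereal_inf_tmp => _ [U [ABU Ud] <-].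
  pose UU C i := if U i `&` C == set0 then set0 else U i.
  have pre C : C `<=` A `|` B -> hausdorff_premeasure s d C <=
      \sum_(i <oo | UU C i != set0) diam (UU C i) `^ s.
    move=> CAB; apply: ereal_inf_lbound; exists (UU C) => //; split.
      move=> x Cx; have [i _ Uix] := ABU _ (CAB _ Cx); exists i => //.
      by rewrite /UU; case: eqVneq => // UC0; have : set0 x by rewrite -UC0.
    by move=> i; rewrite /UU; case: ifP => // _; rewrite diam0 lee_fin ltW.
  apply: le_trans (leeD (pre A (@subsetUl _ _ _)) (pre B (@subsetUr _ _ _))) _.
  rewrite (eseries_mkcond (fun i => diam (UU A i) `^ s)).
  rewrite (eseries_mkcond (fun i => diam (UU B i) `^ s)).
  rewrite (eseries_mkcond (fun i => diam (U i) `^ s)).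
  rewrite -nneseriesD; last 2 first.
  - by move=> i _ _; case: ifP => // _; exact: poweR_ge0.
  - by move=> i _ _; case: ifP => // _; exact: poweR_ge0.
  apply: lee_nneseries => i _.
    by move=> _; apply: adde_ge0; case: ifP => // _; exact: poweR_ge0.
  rewrite /UU; have [_|/set0P[x [Ux Ax]]] := eqVneq (U i `&` A) set0.
    rewrite eqxx add0e; have [_|_] := eqVneq (U i `&` B) set0 => //.
    by rewrite eqxx /=; case: ifP => // _; exact: poweR_ge0.
  have [_|/set0P[y [Uy By]]] := eqVneq (U i `&` B) set0.
    by rewrite eqxx/= adde0.
  have := Ud i; rewrite leNgt => /negP[]; apply: lt_le_trans (_ : g%:E <= _).
    by rewrite lte_fin.
  apply: (@le_trans _ _ `|x - y|%:E); first by rewrite lee_fin gAB.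
  rewrite /diam le_max; apply/orP; right; apply: ereal_sup_ubound.
  by exists x => //; exists y.
have antitone (C : set V) (d d' : R) : (d <= d')%R ->
    hausdorff_premeasure s d' C <= hausdorff_premeasure s d C.
  move=> dd'; apply: ereal_inf_le_tmp => _ [U [CU Ud] <-]; exists U => //.
  by split=> // i; rewrite (le_trans (Ud i))// lee_fin.
(* The two measures on the left are suprema over independent scales. *)
have both (d d' : R) : (0 < d)%R -> (0 < d')%R ->
    hausdorff_premeasure s d A + hausdorff_premeasure s d' B <=
    hausdorff_measure s (A `|` B).
  move=> d0 d'0; pose e : R := (Num.min (Num.min d d') (g / 2))%R.
  have e0 : (0 < e)%R by rewrite !lt_min d0 d'0 divr_gt0.
  have eg : (e < g)%R by rewrite gt_min; apply/orP; right; lra.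
  apply: le_trans (le_trans (small e e0 eg) _); last first.
    exact: le_hausdorff_premeasure_measure.
  by apply: leeD; apply: antitone; rewrite !ge_min lexx ?orbT.
have [BU|BU] := leP +oo (hausdorff_measure s (A `|` B)).
  by rewrite (le_trans _ BU)// leey.
have fin C : C `<=` A `|` B -> hausdorff_measure s C \is a fin_num.
  by move=> CAB; rewrite ge0_fin_numE// (le_lt_trans _ BU)// le_hausdorff_measure.
have finA := fin A (@subsetUl _ _ _); have finB := fin B (@subsetUr _ _ _).
have finp (C : set V) (d : R) : (0 < d)%R -> hausdorff_measure s C \is a fin_num ->
    hausdorff_premeasure s d C \is a fin_num.
  move=> d0; rewrite !ge0_fin_numE ?hausdorff_premeasure_ge0//.
  by apply: le_lt_trans; exact: le_hausdorff_premeasure_measure.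
rewrite -leeBrDr//; apply: hausdorff_measure_le => d d0.
rewrite leeBrDr// addeC -leeBrDr ?finp//; apply: hausdorff_measure_le => d' d'0.
by rewrite leeBrDr ?finp// addeC both.
Qed.

End hausdorff.
(** * Regular sets are evenly spread *)

Section regular_sets.
Context {R : realType} {V : normedModType R}.
Implicit Types (E K : set V) (s C t r : R) (F : seq V).

(** A point outside the support has a null neighbourhood, hence lies in a null
    ball of a countable family: separability makes the union of them null. *)
Lemma outside_spt_negligible (mu : {outer_measure set V -> \bar R}) K (q : nat -> V) :
  (forall x (e : R), 0 < e -> exists n, `|x - q n| < e) ->
  mu (K `\` spt (restriction mu K)) = 0%E.
Proof.
move=> q_dense; pose B (p : nat * nat) := ball (q p.1) p.2.+1%:R^-1 `&` K.
pose F m := if unpickle m is Some p then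
  if mu (B p) == 0%E then B p else set0 else set0.
have F0 m : mu (F m) = 0%E.
  by rewrite /F; case: unpickle => [p|//]; case: eqP.
apply/eqP; rewrite eq_le outer_measure_ge0 andbT.
apply: (@le_trans _ _ (mu (\bigcup_m F m))).
  apply: le_outer_measure => x [Kx]; rewrite /spt/= => /existsNP[U].
  move=> /not_implyP[oU] /not_implyP[Ux] /negP; rewrite -leNgt => muU.
  have /nbhs_ballP[e /= e0 eU] : nbhs x U by exact: open_nbhs_nbhs.
  have [k ke] : exists k : nat, k.+1%:R^-1 < e / 2 :> R.
    exists (Num.truncn (2 / e)); rewrite -[e / 2]invrK ltf_pV2 ?posrE ?invr_gt0 ?ltr0n ?divr_gt0//.
    by rewrite invf_div truncnS_gt.
  have k0 : 0 < k.+1%:R^-1 :> R by rewrite invr_gt0 ltr0n.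
  have [n xqn] := q_dense x _ k0.
  exists (pickle (n, k)) => //; rewrite /F pickleK ifT; last first.
    rewrite eq_le outer_measure_ge0 andbT (le_trans _ muU)//.
    apply: le_outer_measure => z [Bz Kz]; split => //; apply: eU.
    move: Bz; rewrite -!ball_normE /= => Bz; rewrite (le_lt_trans (ler_distD (q n) _ _))//.
    by move: ke xqn Bz; set i := _^-1; lra.
  by split => //; rewrite /= -ball_normE /= distrC.
apply: le_trans (outer_measure_sigma_subadditive _ _) _.
by rewrite eseries0.
Qed.

(** At scales between [rho * r] and [r], the finite sets [F] behave like a
    measure of dimension at least one.  [F] is a list because only
    proportions matter. *)
Definition evenly_spread E (A r0 : R) : Prop :=
  forall y r rho, E y -> 0 < r <= r0 -> 0 < rho < 1 ->
  exists F, [/\ F != [::], {in F, forall z, E z /\ `|y - z| <= r / 2} &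
    {in F, forall z u, 1 <= u ->
      (count (fun z' => `|z - z'| <= u * rho * r) F)%:R <=
      A * u * rho * (size F)%:R}].

Definition separated t F : Prop :=
  uniq F /\ {in F &, forall x y, x != y -> t < `|x - y|}.

Lemma le_size_separated (H : {outer_measure set V -> \bar R}) K c t F : 0 < t ->
  (forall A B (g : R), 0 < g ->
     (forall x y, A x -> B y -> (g <= `|x - y|)%R) ->
     (H A + H B <= H (A `|` B))%E) ->
  {in F, forall x, (c%:E <= H (closed_ball x (t / 3) `&` K))%E} ->
  separated t F ->
  (((size F)%:R * c)%:E <=
    H ([set z | exists2 x, x \in F & closed_ball x (t / 3) z] `&` K))%E.
Proof.
move=> t0 Hsep; have t30 : 0 < t / 3 by rewrite divr_gt0.
elim: F => [_ _|x F IH xF [/= /andP[xNF uF] sF]]; first by rewrite mul0r.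
have sub z : z \in F -> z \in x :: F by rewrite inE orbC => ->.
have {}IH := IH (fun z zF => xF z (sub z zF))
  (conj uF (fun y z yF zF => sF y z (sub _ yF) (sub _ zF))).
rewrite /= -addn1 natrD mulrDl mul1r EFinD.
apply: le_trans (leeD IH (xF x (mem_head _ _))) _.
apply: le_trans (Hsep _ _ (t / 3) t30 _) _; last first.
  apply: le_outer_measure => z [[[y yF yz] Kz]|[xz Kz]]; split => //.
    by exists y => //; exact: sub.
  by exists x => //; rewrite inE eqxx.
move=> z w [[y yF]]; rewrite !closed_ballE// /closed_ball_ /= => yz _ [xw _].
have yx : t < `|y - x|.
  by apply: sF; rewrite ?inE ?eqxx ?yF ?orbT//; apply: contraNneq xNF => <-.
have := ler_distD z y x; have := ler_distD w z x.
move: yz xw; rewrite [`|x - w|]distrC; lra.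
Qed.

Lemma measure_cover_le (H : {outer_measure set V -> \bar R}) K c t F :
  {in F, forall x, (H (closed_ball x t `&` K) <= c%:E)%E} ->
  (H ([set z | exists2 x, x \in F & closed_ball x t z] `&` K) <=
    ((size F)%:R * c)%:E)%E.
Proof.
elim: F => [_|x F IH xF].
  rewrite mul0r (_ : _ `&` _ = set0) ?outer_measure0// -subset0.
  by move=> z [[w]].
rewrite /= -addn1 natrD mulrDl mul1r EFinD.
apply: le_trans (leeD (IH _) (xF x (mem_head _ _))); last first.
  by move=> z zF; apply: xF; rewrite inE zF orbT.
apply: le_trans (outer_measureU2 _ _ _); apply: le_outer_measure.
move=> z [[w]]; rewrite inE => /predU1P[->|wF] wz Kz; first by right.
by left; split => //; exists w.
Qed.

Lemma maximal_separated E y r t (N : nat) : 0 < t ->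
  (forall F, separated t F -> {in F, forall z, E z /\ `|y - z| <= r} ->
     (size F <= N)%N) ->
  exists F, [/\ separated t F, {in F, forall z, E z /\ `|y - z| <= r} &
    forall z, E z -> `|y - z| <= r -> exists2 x, x \in F & `|x - z| <= t].
Proof.
move=> t0 bnd; pose good F := separated t F /\ {in F, forall z, E z /\ `|y - z| <= r}.
pose P n := `[< exists2 F, good F & size F = n >].
have P0 : exists n, P n by exists 0%N; apply/asboolP; exists [::] => //; split.
have PN n : P n -> (n <= N)%N by move=> /asboolP[F [sF FE] <-]; exact: bnd.
case: (ex_maxnP P0 PN) => n /asboolP[F [[uF sF] FE] sizeF] maxn.
exists F; split => // z Ez yz; apply: contrapT => /forall2NP far.
have {}far x : x \in F -> t < `|x - z|.
  by move=> xF; case: (far x) => // /negP; rewrite ltNge.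
have zF : z \notin F.
  by apply/negP => /far; rewrite subrr normr0 ltNge ltW.
have /maxn : P n.+1; last by rewrite ltnn.
apply/asboolP; exists (z :: F); last by rewrite /= sizeF.
split; last by move=> x; rewrite inE => /predU1P[->//|/FE].
split; first by rewrite /= zF.
move=> a b; rewrite !inE => /predU1P[->|aF] /predU1P[->|bF].
- by rewrite eqxx.
- by rewrite distrC => _; exact: far.
- by move=> _; exact: far.
- exact: sF.
Qed.


(** The list [F] is a maximal [rho * r]-separated subset.  The balls around its
    points cover, so there are at least of order [rho ^ - s] of them; the balls
    of a third of the radius are disjoint, so at most of order [u ^ s] of them
    are within [u * rho * r] of a given one.  The ratio is of order
    [(u * rho) ^ s], and [s >= 1]. *)
Lemma AD_regular_evenly_spread s C K (q : nat -> V) : 1 <= s -> 1 <= C ->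
  (forall x (e : R), 0 < e -> exists n, `|x - q n| < e) ->
  (0 < hausdorff_measure s K)%E ->
  AD_regular_measure s C (restriction (hausdorff_measure s) K) ->
  exists E A r0, [/\ E `<=` K, E !=set0, 0 < A, 0 < r0 & evenly_spread E A r0].
Proof.
move=> s1 C1 q_dense HK; set nu := restriction _ _ => reg.
pose H : {outer_measure set V -> \bar R} := hausdorff_measure s.
have Hout : H (K `\` spt nu) = 0%E by exact: outside_spt_negligible q_dense.
pose E := K `&` spt nu.
(* The centres have to lie in [K]; the part of [K] outside the support does not
   contribute to the measure of balls. *)
have HE A : (H (A `&` K) <= H (A `&` E))%E.
  apply: (@le_trans _ _ (H (A `&` E `|` (K `\` spt nu)))).
    apply: le_outer_measure => x [Ax Kx]; case: (pselect (spt nu x)) => h.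
      by left; split.
    by right.
  apply: le_trans (outer_measureU2 _ _ _) _.
  by rewrite [X in (_ + X)%E]Hout adde0.
have HE0 : (0 < H E)%E.
  by apply: lt_le_trans HK _; have := HE setT; rewrite !setTI.
have s0 : 0 < s by rewrite (lt_le_trans _ s1).
have [x Ex] : E !=set0.
  by apply/set0P/eqP => E0; move: HE0; rewrite E0 outer_measure0 ltxx.
have [y Ey xy] : exists2 y, E y & y != x.
  apply: contrapT => /forall2NP all; move: HE0; rewrite ltNge => /negP; apply.
  rewrite -(hausdorff_measure1 x s0); apply: le_outer_measure => y Ey /=.
  by case: (all y) => // /negP; rewrite negbK => /eqP.
pose r0 := `|x - y|.
have r00 : 0 < r0 by rewrite normr_gt0 subr_eq0 eq_sym.
have diamE r : r <= r0 -> (r%:E <= diam (spt nu))%E.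
  move=> rr; rewrite /diam le_max; apply/orP; right.
  apply: (@le_trans _ _ r0%:E); first by rewrite lee_fin.
  apply: ereal_sup_ubound; exists x; first by case: Ex.
  by exists y => //; case: Ey.
have low z r : E z -> 0 < r <= r0 ->
    ((r `^ s / C)%:E <= H (closed_ball z r `&` K))%E.
  by move=> [_ Ez] /andP[r_0 rr0]; case: (reg z r Ez r_0 (diamE _ rr0)).
have upp z r : E z -> 0 < r <= r0 ->
    (H (closed_ball z r `&` K) <= (C * r `^ s)%:E)%E.
  by move=> [_ Ez] /andP[r_0 rr0]; case: (reg z r Ez r_0 (diamE _ rr0)).
have C0 : 0 < C by lra.
have pack F z rad t : separated t F -> E z -> 0 < t -> 0 < rad ->
    rad + t / 3 <= r0 -> {in F, forall w, E w /\ `|z - w| <= rad} ->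
    (size F)%:R * ((t / 3) `^ s / C) <= C * (rad + t / 3) `^ s.
  move=> sF Ez t0 rad0 rr0 FE; rewrite -lee_fin.
  apply: le_trans (@le_size_separated H K _ _ _ t0 _ _ sF) _; last first.
  - apply: le_trans (upp z (rad + t / 3) Ez _); last by apply/andP; split; lra.
    apply: le_outer_measure => w [[v vF vw] Kw]; split => //; move: vw.
    rewrite !closed_ballE ?divr_gt0//; last lra.
    rewrite /closed_ball_/= => vw; have [_ zv] := FE v vF.
    by have := ler_distD v z w; lra.
  - move=> w /FE[Ew _]; apply: low => //; apply/andP; split; lra.
  - by move=> A B g g0; exact: hausdorff_measureU_separated.
exists E, (C ^+ 4 * 12 `^ s), r0; split => //; first by move=> z [].
- by exists x.
- by rewrite mulr_gt0 ?exprn_gt0 ?powR_gt0.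
move=> z r rho Ez /andP[r_0 rr0] /andP[rho0 rho1].
pose t := rho * r; have t0 : 0 < t by rewrite mulr_gt0.
have tr : t < r by rewrite /t gtr_pMl.
have ts0 (a : R) : 0 < a -> 0 < a `^ s by exact: powR_gt0.
have [N bndN] : exists N : nat, forall F, separated t F ->
    {in F, forall w, E w /\ `|z - w| <= r / 2} -> (size F <= N)%N.
  pose B := C * (r / 2 + t / 3) `^ s / ((t / 3) `^ s / C).
  exists (Num.truncn B) => F sF FE.
  rewrite -ltnS -(ltr_nat R) (le_lt_trans _ (truncnS_gt _))//.
  rewrite ler_pdivlMr ?divr_gt0 ?ts0//; last by rewrite divr_gt0.
  by apply: (pack F z) => //; [rewrite divr_gt0|lra].
have [F [sF FE cov]] := maximal_separated t0 bndN.
have lowF : (r / 2) `^ s / C <= (size F)%:R * (C * t `^ s).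
  rewrite -lee_fin; apply: le_trans (low z (r / 2) Ez _) _.
    by apply/andP; split; lra.
  apply: le_trans (HE _) _.
  apply: le_trans (@measure_cover_le H K _ t F _); last first.
    by move=> w /FE[Ew _]; apply: upp => //; apply/andP; split; lra.
  apply: le_outer_measure => w [zw [Kw nuw]]; split => //.
  move: zw; rewrite closed_ballE; last lra.
  rewrite /closed_ball_/= => zw.
  have [v vF vw] := cov w (conj Kw nuw) zw.
  by exists v => //; rewrite closed_ballE// /closed_ball_/=.
exists F; split => //.
  apply/eqP => F0; move: lowF; rewrite F0/= mul0r leNgt => /negP; apply.
  by rewrite divr_gt0// ts0// divr_gt0.
have c12 : 12 <= 12 `^ s :> R by rewrite -[leLHS]powRr1 ?ler_powR//; lra.
move=> w /FE[Ew zw] u u1; set G := [seq z' <- F | `|w - z'| <= u * rho * r].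
rewrite -size_filter -/G.
(* For [u * rho] near one the bound is trivial; otherwise the ball below has
   radius at most [r0]. *)
have [ubig|usmall] := leP 2^-1 (u * rho).
  apply: (@le_trans _ _ (size F)%:R); first by rewrite ler_nat size_filter count_size.
  rewrite -[leLHS]mul1r ler_wpM2r// -mulrA.
  apply: (@le_trans _ _ (2 * (u * rho))); first lra.
  rewrite ler_wpM2r//; first lra.
  rewrite -[leLHS]mul1r ler_pM//; first by rewrite exprn_ege1.
  lra.
have sG : separated t G.
  case: sF => uF sF; split; first exact: filter_uniq.
  by move=> a b; rewrite !mem_filter => /andP[_ aF] /andP[_ bF]; exact: sF.
have u0 : 0 < u by lra.
have ur0 : 0 < u * rho by rewrite mulr_gt0.
have urr : u * rho * r <= r / 2 by rewrite mulrC ler_wpM2l//; lra.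
have ttur : t <= u * rho * r by rewrite -mulrA ler_peMl// ltW.
have packG : (size G)%:R * ((t / 3) `^ s / C) <= C * (u * t + t / 3) `^ s.
  have tE : u * t = u * rho * r by rewrite /t mulrA.
  rewrite tE; apply: (pack G w) => //; [exact: mulr_gt0|lra|].
  by move=> v; rewrite mem_filter => /andP[wv vF]; split; first by case: (FE v vF).
have pw3 : 0 < (t / 3) `^ s by rewrite ts0// divr_gt0.
have nG : (size G)%:R <= C ^+ 2 * (6 * u) `^ s.
  have : (size G)%:R * ((t / 3) `^ s / C) <= C * ((6 * u) `^ s * (t / 3) `^ s).
    apply: le_trans packG _; rewrite ler_wpM2l ?(ltW C0)// -powRM; [|lra|lra].
    have tut := ler_peMl (ltW t0) u1.
    by apply: ge0_ler_powR; rewrite ?nnegrE; lra.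
  rewrite (_ : (size G)%:R * _ = (size G)%:R / C * (t / 3) `^ s); last by field; rewrite gt_eqF.
  rewrite mulrA ler_pM2r// ler_pdivrMr// => /le_trans; apply.
  by rewrite le_eqVlt; apply/orP; left; apply/eqP; ring.
have nF : (1 / (2 * rho)) `^ s <= C ^+ 2 * (size F)%:R.
  have e : r / 2 = 1 / (2 * rho) * t by rewrite /t; field; rewrite gt_eqF.
  move: lowF; rewrite e powRM; [|by rewrite divr_ge0// mulr_ge0// ltW|exact: ltW].
  rewrite ler_pdivrMr// => lowF; rewrite -(ler_pM2r (ts0 _ t0)).
  apply: le_trans lowF _; rewrite le_eqVlt; apply/orP; left; apply/eqP; ring.
apply: le_trans nG _.
have -> : 6 * u = 12 * (u * rho) * (1 / (2 * rho)) by field; rewrite gt_eqF.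
rewrite powRM; [|lra|by rewrite divr_ge0// mulr_ge0// ltW].
rewrite powRM; [|lra|lra].
have -> : C ^+ 4 * 12 `^ s * u * rho * (size F)%:R =
  C ^+ 2 * (12 `^ s * (u * rho) * (C ^+ 2 * (size F)%:R)) by ring.
rewrite ler_wpM2l ?exprn_ge0 ?(ltW C0)//.
apply: ler_pM => //; rewrite ?mulr_ge0 ?powR_ge0//.
rewrite ler_wpM2l ?powR_ge0//.
(* [u * rho] is at most one and [s] at least one *)
by rewrite -[leRHS](powRr1 (ltW ur0)); apply: ger_powR => //; rewrite ur0/=; lra.
Qed.

End regular_sets.
(** * Lipschitz graphs *)

(** A sequence that increases by at most [K] in each step cannot jump over more
    than [K] integers, so it needs many values to become large. *)
Lemma discrete_ivt (h : nat -> nat) (K n : nat) (T : seq nat) :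
  h 0%N = 0%N -> (forall j, (j < n)%N -> (h j.+1 <= h j + K)%N) ->
  (forall j, (j < n)%N -> h j \in T) -> (h n <= K * size T)%N.
Proof.
move=> h0 step hT.
(* counting only the values below [v] makes the induction work *)
have below v : (exists2 j, (j <= n)%N & (v <= h j)%N) ->
    (v <= K * size [seq w <- undup T | (w < v)%N])%N.
  elim/ltn_ind: v => v IH; case: (posnP v) => [->//|v0] [j jn vj].
  (* the first index at which [h] reaches [v], and the one before it *)
  have exj : exists j, (v <= h j)%N by exists j.
  case: (ex_minnP exj) => -[|i]; first by rewrite h0 leqn0 => /eqP; lia.
  move=> vi imin; have lt_in : (i < n)%N by have := imin j vj; lia.
  have hiv : (h i < v)%N by rewrite ltnNge; apply/negP => /imin; lia.
  have hi : (h i <= K * size [seq w <- undup T | (w < h i)%N])%N.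
    by apply: IH => //; exists i => //; exact: ltnW.
  have lt_size : (size [seq w <- undup T | (w < h i)%N] <
                  size [seq w <- undup T | (w < v)%N])%N.
    have -> : (size [seq w <- undup T | (w < h i)%N]).+1 =
        size (h i :: [seq w <- undup T | (w < h i)%N]) by [].
    apply: uniq_leq_size.
      by rewrite /= mem_filter ltnn/= filter_uniq// undup_uniq.
    move=> w; rewrite inE !mem_filter mem_undup => /predU1P[->|/andP[whi ->]].
      by rewrite hiv hT.
    by rewrite (ltn_trans whi hiv).
  have := step i lt_in; nia.
apply: leq_trans (below (h n) _) _; first by exists n.
rewrite leq_mul2l size_filter (leq_trans (count_size _ _)) ?orbT//.
exact: size_undup.
Qed.

(** The function [g], defined on the indices where [O] holds, is Lipschitz with
    constant [L].  Extending it to the remaining indices in steps of [2 * L]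
    makes up for the jumps that it may make across gaps, at the price of one
    additional value for each index added. *)
Lemma chain_count (O : pred nat) (g : nat -> nat) (L j0 m : nat) (G : seq nat) :
  O j0 -> O (j0 + m)%N -> g j0 = 0%N ->
  (forall i j, O i -> O j -> (i < j)%N -> (g j <= g i + L * (j - i).+1)%N) ->
  (forall i, O i -> g i \in G) ->
  (g (j0 + m) <= 2 * L * (size G + count (predC O) (iota j0 m)))%N.
Proof.
move=> O0 Om g0 gL gG; pose h := fix h i := if i is i'.+1 then
  if O (j0 + i)%N then g (j0 + i)%N else (h i' + 2 * L)%N else 0%N.
have hO i : O (j0 + i)%N -> h i = g (j0 + i)%N.
  by case: i => [|i] /=; [rewrite addn0 g0|move=> ->].
have last i : exists2 i', (i' <= i)%N & O (j0 + i')%N /\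
    h i = (g (j0 + i') + (i - i') * (2 * L))%N.
  elim: i => [|i [i' i'i [Oi' hi]]].
    by exists 0%N => //; rewrite addn0 g0 mul0n.
  case: (boolP (O (j0 + i.+1)%N)) => Oi.
    by exists i.+1 => //; rewrite subnn mul0n addn0 hO.
  exists i'; first exact: leqW.
  by split => //; rewrite /= (negbTE Oi) hi subSn// mulSn; lia.
rewrite -(hO m)//.
have -> : count (predC O) (iota j0 m) = size [seq h (i - j0)%N | i <- iota j0 m & ~~ O i].
  by rewrite size_map size_filter.
rewrite -size_cat; apply: discrete_ivt => // i im.
  case: (boolP (O (j0 + i.+1)%N)) => Oi; last by rewrite /= (negbTE Oi).
  have [i' i'i [Oi' ->]] := last i; rewrite hO//.
  have := gL _ _ Oi' Oi; nia.
rewrite mem_cat; case: (boolP (O (j0 + i)%N)) => Oi; first by rewrite hO// gG.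
apply/orP; right; apply/mapP; exists (j0 + i)%N; last by rewrite addKn.
by rewrite mem_filter Oi mem_iota; lia.
Qed.

(** The proportion of occupied cells does not increase with the level.  At a
    level where it is close to its infimum, the occupied cells are on average
    almost full at any finer level, hence one of them is. *)
Lemma dense_cell (R : realType) (P : nat -> nat -> bool) (c eta : R) :
  0 < c -> 0 < eta < 1 ->
  (forall k l J i, (i < 2 ^ l)%N -> P (k + l)%N (J * 2 ^ l + i)%N -> P k J) ->
  (forall k, c * 2 ^+ k <= (count (P k) (iota 0 (2 ^ k)))%:R) ->
  exists k, forall l, exists J,
    (count (predC (P (k + l)%N)) (iota (J * 2 ^ l) (2 ^ l)))%:R <= eta * 2 ^+ l.
Proof.
move=> c0 /andP[eta0 eta1] parent lowP.
pose n k := count (P k) (iota 0 (2 ^ k)).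
pose a k : R := (n k)%:R / 2 ^+ k.
have p2 k : 0 < 2 ^+ k :> R by rewrite exprn_gt0.
have ca k : c <= a k by rewrite ler_pdivlMr.
have inf_a : has_inf (range a).
  by split; [exists (a 0%N); exists 0%N|exists c => _ [k _ <-]].
pose m := inf (range a).
have ma k : m <= a k by apply: ge_inf; [exact: inf_a.2|exists k].
have cm : c <= m by apply: lb_le_inf => [|_ [k _ <-]//]; exists (a 0%N); exists 0%N.
have e0 : 0 < m * (eta / (1 - eta)).
  by rewrite mulr_gt0 ?divr_gt0// ?subr_gt0//; lra.
have [_ [k _ <-] ak] := inf_adherent e0 inf_a.
have {}ak : a k * (1 - eta) < m.
  rewrite -ltr_pdivlMr ?subr_gt0//.
  suff -> : m / (1 - eta) = m + m * (eta / (1 - eta)) by [].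
  by field; rewrite gt_eqF// subr_gt0.
exists k => l; apply: contrapT => /forallNP full.
pose o J := count (P (k + l)%N) (iota (J * 2 ^ l) (2 ^ l)).
have holesE J : (count (predC (P (k + l)%N)) (iota (J * 2 ^ l) (2 ^ l)))%:R =
    2 ^+ l - (o J)%:R :> R.
  apply/eqP; rewrite eq_sym subr_eq -natrD addnC count_predC size_iota.
  by rewrite natrX.
have oP J : (o J)%:R <= (P k J)%:R * ((1 - eta) * 2 ^+ l) :> R.
  case: (boolP (P k J)) => PJ.
    by have /negP := full J; rewrite -ltNge holesE mul1r; lra.
  rewrite mul0r (_ : o J = 0%N)//; apply/eqP; rewrite -leqn0 leqNgt -has_count.
  apply/hasP => -[i]; rewrite mem_iota => ilt Pi; move/negP: PJ; apply.
  by apply: (parent k l J (i - J * 2 ^ l)%N); [lia|rewrite subnKC//; lia].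
have nE : n (k + l)%N = (\sum_(0 <= J < 2 ^ k) o J)%N.
  rewrite /n -sum1_count expnD.
  rewrite -[X in iota 0 X]subn0 -/(index_iota 0 (2 ^ k * 2 ^ l)).
  rewrite big_mkcond big_nat_mul /=.
  by apply: eq_bigr => J _; rewrite -big_mkcond /o -sum1_count /index_iota mulSn addnK.
have : (n (k + l)%N)%:R <= (n k)%:R * ((1 - eta) * 2 ^+ l) :> R.
  rewrite nE natr_sum.
  apply: (@le_trans _ _ (\sum_(0 <= J < 2 ^ k) (P k J)%:R * ((1 - eta) * 2 ^+ l))).
    exact: ler_sum.
  rewrite -mulr_suml ler_wpM2r ?mulr_ge0 ?subr_ge0 ?(ltW (p2 _)) ?(ltW eta1)//.
  rewrite /n -sum1_count [in leRHS]big_mkcond natr_sum /index_iota subn0.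
  by apply: ler_sum => J _; case: (P k J).
have := ma (k + l)%N; rewrite /a ler_pdivlMr// exprD => h1 h2.
have := le_trans h1 h2; rewrite leNgt => /negP; apply.
rewrite mulrA mulrA ltr_pM2r//; move: ak; rewrite /a.
by rewrite mulrAC ltr_pdivrMr.
Qed.

(** Nonnegative numbers only are to be counted, since truncation sends the
    negative ones to 0; [M] only has to be large. *)
Definition cells (R : realType) (M : nat) (delta : R) (A : set R) : {set 'I_M} :=
  [set j : 'I_M | `[< exists2 a, A a & Num.truncn (a / delta) = j >]].

Lemma le_size_fibers (R : realType) (T : eqType) (F : seq T) (f : T -> nat)
    (S : seq nat) (B : R) :
  {in F, forall z, f z \in S} ->
  (forall j, j \in S -> (count (fun z => f z == j) F)%:R <= B) ->
  (size F)%:R <= (size S)%:R * B.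
Proof.
move=> fS fB; apply: (@le_trans _ _ (\sum_(j <- S) (count (fun z => f z == j) F)%:R)).
  rewrite -natr_sum ler_nat.
  have -> : (\sum_(j <- S) count (fun z => f z == j) F =
             \sum_(z <- F) count (fun j => f z == j) S)%N.
    under eq_bigr do rewrite -sum1_count big_mkcond.
    by rewrite exchange_big; apply: eq_bigr => z _; rewrite -sum1_count [RHS]big_mkcond.
  rewrite -sum1_size big_seq [leqRHS]big_seq leq_sum// => z zF.
  by rewrite -has_count; apply/hasP; exists (f z) => //; exact: fS.
have -> : (size S)%:R * B = \sum_(j <- S) B.
  by rewrite big_const_seq count_predT iter_addr addr0 mulr_natl.
by rewrite big_seq [leRHS]big_seq ler_sum// => j; exact: fB.
Qed.

Lemma le_count_in (T : eqType) (F : seq T) (p q : pred T) :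
  {in F, subpred p q} -> (count p F <= count q F)%N.
Proof.
move=> pq; rewrite -[leqLHS](@eq_in_count _ (fun x => p x && q x)); last first.
  by move=> x xF; case: (boolP (p x)) => // /(pq x xF) ->.
by apply: sub_count => x /andP[].
Qed.

(** Points are missing in less than a quarter of the block, so both its first
    and its last quarter contain one. *)
Lemma far_apart_in_dense_block (O : pred nat) (b q L : nat) : (0 < q)%N ->
  (0 < L)%N -> (4 * L * count (predC O) (iota b (4 * q)) <= q)%N ->
  exists j0 j1, [/\ O j0, O j1, (j0 + (2 * q).+1 <= j1)%N &
    (count (predC O) (iota j0 (j1 - j0)) <= count (predC O) (iota b (4 * q)))%N].
Proof.
move=> q0 L0; set holes := count _ _ => holes_le.
have count_sub a m : (b <= a)%N -> (a + m <= b + 4 * q)%N ->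
    (count (predC O) (iota a m) <= holes)%N.
  move=> ba am; rewrite /holes -(subnKC ba).
  have -> : (4 * q = (a - b) + (m + (b + 4 * q - (a + m))))%N by lia.
  by rewrite !iotaD !count_cat; lia.
have occupied a : (b <= a)%N -> (a + q <= b + 4 * q)%N ->
    exists2 i, (a <= i < a + q)%N & O i.
  move=> ba aq; have := count_sub a q ba aq; have := count_predC O (iota a q).
  rewrite size_iota; case: (boolP (has O (iota a q))) => [/hasP[i]|].
    by rewrite mem_iota => iaq Oi _ _; exists i.
  rewrite has_count -leqNgt leqn0 => /eqP ->; have := holes_le; nia.
have [j0 j0b Oj0] := occupied b (leqnn b) ltac:(lia).
have [j1 j1b Oj1] := occupied (b + 3 * q)%N ltac:(lia) ltac:(lia).
exists j0, j1; split => //; first by lia.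
by apply: count_sub; lia.
Qed.

Lemma exists_pow2_lt (R : realType) (a b : R) : 0 < b -> exists n, a / 2 ^+ n < b.
Proof.
move=> b0; exists (Num.truncn (a / b)).+1; rewrite ltr_pdivrMr ?exprn_gt0//.
rewrite mulrC -ltr_pdivrMr//; apply: lt_trans (truncnS_gt _) _.
by rewrite -natrX ltr_nat ltn_expl.
Qed.

Section graph_case.
Context {R : realType} {V : normedModType R}.

(** The map [t] is the coordinate of a Lipschitz graph.  In the almost full cell
    [J], the points [p i] form a chain along which the distance [g i] to its
    first point [p j0] is Lipschitz, and it grows to a fixed proportion of the
    number of subcells. *)
Lemma graph_distance_cells (E : set V) (A r0 r1 L : R) (y0 : V) (t : V -> R) :
  evenly_spread E A r0 -> 0 < A -> E y0 -> 0 < r1 <= r0 -> 1 <= L ->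
  (forall x y, `|t x - t y| <= 2 * `|x - y|) ->
  (forall x y, E x -> E y -> `|y0 - x| <= r1 / 2 -> `|y0 - y| <= r1 / 2 ->
    `|x - y| <= L * `|t x - t y|) ->
  exists2 c : R, 0 < c & forall delta0 : R, 0 < delta0 -> exists delta M,
    0 < delta < delta0 /\ c / delta <= #|cells M delta (distance_set E)|%:R.
Proof.
move=> spread A0 Ey0 /andP[r10 r1r0] L1 t_lip t_colip.
pose near x := E x /\ `|y0 - x| <= r1 / 2.
have [W WE W0] : exists2 W, W = 3 * r1 & 0 < W by exists (3 * r1) => //; lra.
(* the coordinate rescaled to the unit interval *)
pose tau x := (t x - t y0 + r1) / W.
have tauB x y : t x - t y = W * (tau x - tau y) by rewrite /tau; field; rewrite gt_eqF.
have tau01 x : near x -> 0 <= tau x < 1.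
  move=> [_ xy]; rewrite /tau divr_ge0 ?(ltW W0)//= ?ltr_pdivrMr//.
    have := t_lip x y0; rewrite distrC -distrC [`|x - y0|]distrC WE mul1r.
    by rewrite ler_norml => /andP[]; lra.
  have := t_lip x y0; rewrite [`|x - y0|]distrC ler_norml => /andP[]; lra.
pose cell k x := Num.truncn (tau x * 2 ^+ k).
have p2 k : 0 < 2 ^+ k :> R by rewrite exprn_gt0.
have cellP k x : near x -> (cell k x)%:R <= tau x * 2 ^+ k < (cell k x).+1%:R.
  by move=> nx; apply: truncn_itv; rewrite mulr_ge0 ?(ltW (p2 _))//; case/andP: (tau01 _ nx).
have cell_dist k x y : near x -> near y ->
    `|x - y| <= L * W * (`|(cell k x)%:R - (cell k y)%:R| + 1) / 2 ^+ k.
  move=> nx ny; case: (nx) (ny) => Ex xy [Ey yy].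
  apply: le_trans (t_colip x y Ex Ey xy yy) _.
  rewrite tauB normrM (gtr0_norm W0) -!mulrA ler_pM2l ?(lt_le_trans ltr01 L1)//.
  rewrite ler_pM2l// ler_pdivlMr// -[X in _ * X](gtr0_norm (p2 k)) -normrM mulrBl.
  have := cellP k x nx; have := cellP k y ny; rewrite -!natr1.
  move: (cell k x)%:R (cell k y)%:R => a b; rewrite ler_norml.
  have := ler_norm (a - b); have := ler_norm (b - a); rewrite [`|b - a|]distrC; lra.
pose P k j := `[< exists2 x, near x & cell k x = j >].
have cell_lt k x : near x -> (cell k x < 2 ^ k)%N.
  move=> nx; rewrite -(ltr_nat R) natrX; have /andP[tau0 tau1] := tau01 x nx.
  have /andP[h _] := cellP k x nx; apply: le_lt_trans h _.
  by rewrite gtr_pMl.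
have parent k l J i : (i < 2 ^ l)%N -> P (k + l)%N (J * 2 ^ l + i)%N -> P k J.
  move=> il /asboolP[x nx cx]; apply/asboolP; exists x => //.
  have := cellP (k + l)%N x nx; rewrite cx => /andP[lo hi].
  apply: truncn_def; apply/andP; split.
    rewrite -(ler_pM2r (p2 l)) -mulrA -exprD; apply: le_trans lo.
    by rewrite -natrX -natrM ler_nat leq_addr.
  rewrite -(ltr_pM2r (p2 l)) -mulrA -exprD; apply: lt_le_trans hi _.
  by rewrite -natrX -natrM ler_nat; lia.
pose c := (3 * A * L)^-1.
have AL0 : 0 < 3 * A * L by rewrite !mulr_gt0//; lra.
have lowP k : c * 2 ^+ k <= (count (P k) (iota 0 (2 ^ k)))%:R.
  pose rho : R := (2 ^+ k.+1)^-1; have rho01 : 0 < rho < 1.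
    by rewrite /rho invr_gt0 p2/= invf_lt1// exprn_egt1// ltr1n.
  have [F [F0 FE Fc]] := spread y0 r1 _ Ey0 (introT andP (conj r10 r1r0)) rho01.
  have F_near z : z \in F -> near z by exact: FE.
  have sF : 0 < (size F)%:R :> R by rewrite ltr0n lt0n size_eq0.
  rewrite -size_filter -(ler_pM2r sF) -(mulrA c) /c ler_pdivrMl//.
  have -> : (3 * A * L) * ((size [seq j <- iota 0 (2 ^ k) | P k j])%:R * (size F)%:R)
    = 2 ^+ k * ((size [seq j <- iota 0 (2 ^ k) | P k j])%:R *
       (3 * A * L / 2 ^+ k * (size F)%:R)) by field; rewrite gt_eqF.
  rewrite ler_pM2l//; apply: (@le_size_fibers R V F (cell k)).
    move=> z /F_near nz; rewrite mem_filter mem_iota add0n leq0n cell_lt// !andbT.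
    by apply/asboolP; exists z.
  move=> j _; have [/hasP[z zF /eqP zj]|] := boolP (has (fun z => cell k z == j) F); last first.
    rewrite has_count -leqNgt leqn0 => /eqP ->.
    by rewrite mulr_ge0 ?divr_ge0 ?(ltW (p2 _)) ?(ltW AL0).
  have := Fc z zF (6 * L) ltac:(lra); rewrite /rho exprS => Fcz.
  apply: (@le_trans _ _ (A * (6 * L) * (2 * 2 ^+ k)^-1 * (size F)%:R)); last first.
    by rewrite le_eqVlt; apply/orP; left; apply/eqP; field; rewrite gt_eqF.
  apply: le_trans Fcz; rewrite ler_nat; apply: le_count_in => z' z'F /= /eqP z'j.
  apply: le_trans (cell_dist k z z' (F_near _ zF) (F_near _ z'F)) _.
  rewrite z'j zj subrr normr0 add0r le_eqVlt; apply/orP; left; apply/eqP.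
  by rewrite WE; field; rewrite gt_eqF.
have [L' LL' L'0] : exists2 L' : nat, L + 1 <= L'%:R & 0 < L'%:R :> R.
  exists (Num.truncn L).+2; last by rewrite ltr0n.
  by rewrite -natr1 lerD2r ltW// truncnS_gt.
have c0 : 0 < c by rewrite invr_gt0.
pose eta : R := (16 * L'%:R)^-1; have eta01 : 0 < eta < 1.
  by rewrite /eta invr_gt0 mulr_gt0//= invf_lt1 ?mulr_gt0//; lra.
have [k dense] := @dense_cell R P c _ c0 eta01 parent lowP.
exists (W / (16 * L'%:R * 2 ^+ k)); first by rewrite divr_gt0 ?mulr_gt0.
move=> delta0 delta00; have [n Wn] := exists_pow2_lt (W / 2 ^+ k.+2) delta00.
(* [q] is a quarter of the number of subcells of [J] *)
pose q := (2 ^ n)%N; pose l := n.+2; have [J holesJ] := dense l.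
have lq : (2 ^ l = 4 * q)%N by rewrite /l /q !expnS mulnA.
have q0 : (0 < q)%N by rewrite expn_gt0.
pose O := P (k + l)%N; pose b := (J * 2 ^ l)%N; pose holes := count (predC O) (iota b (2 ^ l)).
have holes_le : (4 * L' * holes <= q)%N.
  have h : holes%:R <= eta * (4 * q%:R) by rewrite -natrM -lq natrX.
  rewrite -(ler_nat R) !natrM.
  have : (4 * L'%:R) * holes%:R <= (4 * L'%:R) * (eta * (4 * q%:R)) :> R.
    by rewrite ler_pM2l ?mulr_gt0//.
  suff -> : (4 * L'%:R) * (eta * (4 * q%:R)) = q%:R :> R by [].
  by rewrite /eta; field; rewrite gt_eqF.
have [j0 [j1 [Oj0 Oj1 j01 holes_mid]]] : exists j0 j1, [/\ O j0, O j1,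
    (j0 + (2 * q).+1 <= j1)%N & (count (predC O) (iota j0 (j1 - j0)) <= holes)%N].
  move: holes_le; rewrite /holes lq; apply: far_apart_in_dense_block => //.
  by rewrite -(ltr_nat R).
pose p i := xget y0 [set x | near x /\ cell (k + l)%N x = i].
have pP i : O i -> near (p i) /\ cell (k + l)%N (p i) = i.
  by move=> /asboolP[x nx cx]; rewrite /p; case: xgetP => [z -> []|/(_ x)[]].
have [delta deltaE delta_gt0] : exists2 delta, delta = W / 2 ^+ (k + l) & 0 < delta.
  by exists (W / 2 ^+ (k + l)) => //; rewrite divr_gt0.
pose g i := Num.truncn (`|p i - p j0| / delta).
pose M := (Num.truncn (r1 / delta)).+1.
exists delta, M; split.
  rewrite delta_gt0/= (le_lt_trans _ Wn)// deltaE /l -addSnnS -addSnnS exprD.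
  by rewrite invfM mulrA.
pose D := distance_set E; pose G := [seq val j | j <- enum (cells M delta D)].
have pE i : O i -> E (p i) by move=> /pP[[]].
have gG i : O i -> g i \in G.
  move=> Oi; have giM : (g i < M)%N.
    rewrite ltnS le_truncn// ler_pM2r ?invr_gt0//.
    have [[_ pi] _] := pP i Oi; have [[_ pj0] _] := pP j0 Oj0.
    by have := ler_distD y0 (p i) (p j0); rewrite [`|p i - y0|]distrC; lra.
  apply/mapP; exists (Ordinal giM) => //; rewrite mem_enum inE.
  apply/asboolP; exists `|p i - p j0| => //.
  by exists (p i); [exact: pE|exists (p j0); [exact: pE|]].
have sizeG : size G = #|cells M delta D| by rewrite size_map -cardE.
have gL i j : O i -> O j -> (i < j)%N -> (g j <= g i + L' * (j - i).+1)%N.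
  move=> Oi Oj ij; rewrite truncn_le_nat ltr_pdivrMr//.
  have [ni ci] := pP i Oi; have [nj cj] := pP j Oj.
  have := cell_dist (k + l)%N _ _ nj ni; rewrite ci cj.
  rewrite ger0_norm ?subr_ge0 ?ler_nat 1?ltnW// -natrB 1?ltnW// natr1.
  have -> : L * W * (j - i).+1%:R / 2 ^+ (k + l) = L * (j - i).+1%:R * delta.
    by rewrite deltaE; ring.
  move=> pij; apply: le_lt_trans (ler_distD (p i) _ _) _.
  have : `|p i - p j0| < (g i).+1%:R * delta by rewrite -ltr_pdivrMr// truncnS_gt.
  have : L * (j - i).+1%:R * delta <= (L' * (j - i).+1)%N%:R * delta.
    by rewrite ler_pM2r// natrM ler_wpM2r//; lra.
  rewrite -[(g i + _).+1%:R]natr1 natrD -[(g i).+1%:R]natr1.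
  move: pij; rewrite distrC; set u := `|p i - p j|; set v := `|p i - p j0|.
  set a := L * _ * _; set m := (L' * _)%N%:R; set e := (g i)%:R; clear; nra.
have g0 : g j0 = 0%N by rewrite /g subrr normr0 mul0r truncn0.
have j0j1 : (j0 + (j1 - j0) = j1)%N by rewrite subnKC// (leq_trans _ j01)// leq_addr.
have := @chain_count O g L' j0 (j1 - j0) G Oj0; rewrite j0j1 => /(_ Oj1 g0 gL gG).
have gj1 : (q <= g j1)%N.
  rewrite truncn_ge_nat ?divr_ge0 ?(ltW delta_gt0)// ler_pdivlMr//.
  have [n0 c0'] := pP j0 Oj0; have [n1 c1'] := pP j1 Oj1.
  have := t_lip (p j1) (p j0); rewrite tauB normrM (gtr0_norm W0) => tl.
  have /andP[_ lo0] := cellP (k + l)%N _ n0; have /andP[hi1 _] := cellP (k + l)%N _ n1.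
  have gap : (2 * q)%N%:R <= (tau (p j1) - tau (p j0)) * 2 ^+ (k + l).
    rewrite mulrBl; rewrite c0' in lo0; rewrite c1' in hi1.
    apply: le_trans (lerB hi1 (ltW lo0)).
    by rewrite lerBrDr -natrD ler_nat addnS -addSn addnC.
  have : (2 * q)%N%:R * delta <= W * `|tau (p j1) - tau (p j0)|.
    have -> : W * `|tau (p j1) - tau (p j0)| =
        `|tau (p j1) - tau (p j0)| * 2 ^+ (k + l) * delta.
      by rewrite deltaE; field; rewrite gt_eqF.
    rewrite ler_pM2r// (le_trans gap)// ler_pM2r//; exact: ler_norm.
  rewrite natrM; lra.
rewrite -sizeG => chain.
have qG : (q <= 4 * L' * size G)%N.
  by move: gj1 chain holes_mid holes_le; clear; nia.
rewrite deltaE; have -> : W / (16 * L'%:R * 2 ^+ k) / (W / 2 ^+ (k + l)) =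
    (4 * L'%:R)^-1 * q%:R.
  rewrite exprD -[2 ^+ l]natrX lq natrM; field.
  by rewrite (gt_eqF L'0) (gt_eqF W0) (gt_eqF (p2 k)) gt_eqF ?ltr0n.
by rewrite ler_pdivrMl ?mulr_gt0// -!natrM ler_nat.
Qed.
End graph_case.

(** * Growth of the logarithmic count over one scale *)

(** Jensen's inequality for the logarithm, by its tangent at [b]. *)
Lemma sum_ln_le (R : realType) (T : eqType) (F : seq T) (x : T -> R) (b : R) :
  0 < b -> {in F, forall z, 0 < x z} -> \sum_(z <- F) x z <= (size F)%:R * b ->
  \sum_(z <- F) ln (x z) <= (size F)%:R * ln b.
Proof.
move=> b0 x0 sumx.
have ln_tangent z : z \in F -> ln (x z) <= x z / b - 1 + ln b.
  move=> zF; have xb0 : 0 < x z / b by rewrite divr_gt0// x0.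
  have -> : ln (x z) = ln (x z / b) + ln b by rewrite ln_div ?posrE ?x0// subrK.
  rewrite lerD2r -[in leLHS](subrK 1 (x z / b)) addrC le_ln1Dx//; lra.
apply: (@le_trans _ _ (\sum_(z <- F) (x z / b - 1 + ln b))).
  by rewrite big_seq [leRHS]big_seq ler_sum.
have cst (t : R) : \sum_(z <- F) t = (size F)%:R * t.
  by rewrite big_const_seq count_predT iter_addr addr0 mulr_natl.
rewrite !big_split /= -mulr_suml !cst -[leRHS]add0r lerD2r.
by rewrite mulrN1 subr_le0 ler_pdivrMr.
Qed.

(** If [j] belongs to [k] of the sets, it has weight at most [1 / k] in each of
    them, hence total weight at most one. *)
Lemma sum_card_div_multiplicity (R : realType) (T : eqType) (J : finType)
    (F : seq T) (S : T -> {set J}) (U : {set J}) (c : T -> nat) :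
  {in F, forall z, S z \subset U} ->
  {in F, forall z j, j \in S z -> (count (fun z' => j \in S z') F <= c z)%N} ->
  \sum_(z <- F) #|S z|%:R / (c z)%:R <= #|U|%:R :> R.
Proof.
move=> SU Sc; pose m j := count (fun z => j \in S z) F.
have m0 z j : z \in F -> j \in S z -> (0 < m j)%N.
  by move=> zF jS; rewrite -has_count; apply/hasP; exists z.
apply: (@le_trans _ _ (\sum_(z <- F) \sum_(j in U) (j \in S z)%:R / (m j)%:R)).
  rewrite big_seq [leRHS]big_seq; apply: ler_sum => z zF.
  rewrite -sum1_card natr_sum mulr_suml big_mkcond [leRHS]big_mkcond.
  apply: ler_sum => j _; case: (boolP (j \in S z)) => jS; last by case: ifP; rewrite ?mul0r.
  rewrite (fintype.subsetP (SU z zF) _ jS) !mul1r lef_pV2 ?posrE ?ltr0n ?ler_nat.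
  - exact: Sc.
  - exact: leq_trans (m0 z j zF jS) (Sc z zF j jS).
  - exact: m0 jS.
rewrite exchange_big -sum1_card natr_sum; apply: ler_sum => j jU.
rewrite -mulr_suml -natr_sum.
have -> : (\sum_(z <- F) (j \in S z) = m j)%N.
  by rewrite /m -sum1_count [RHS]big_mkcond.
have [->|mj] := posnP (m j); first by rewrite mul0r.
by rewrite divff// pnatr_eq0 -lt0n.
Qed.

(** The index [i] is a projection and [z] a piece: [a i z] is the size of the
    projection of the piece, [u i] that of the whole, and [c i z] the number
    of pieces whose projection may overlap that of [z].  If the overlaps are a
    fraction [Q] of all pieces on average over [i], passing from the pieces to
    the whole gains [- ln Q] for each projection.  This plays the role of the
    chain rule for entropy. *)
Lemma sum_ln_branching (R : realType) (T : eqType) (I : finType) (F : seq T)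
    (a c : I -> T -> nat) (u : I -> nat) (Q B : R) :
  F != [::] -> 0 < Q ->
  (forall i, (0 < u i)%N) -> (forall i, {in F, forall z, (0 < a i z)%N && (0 < c i z)%N}) ->
  (forall i, \sum_(z <- F) (a i z)%:R / (c i z)%:R <= (u i)%:R :> R) ->
  {in F, forall z, \sum_i (c i z)%:R <= #|I|%:R * (Q * (size F)%:R)} ->
  {in F, forall z, B <= \sum_i ln (a i z)%:R} ->
  B - #|I|%:R * ln Q <= \sum_i ln (u i)%:R.
Proof.
move=> F0 Q0 u0 ac0 acu cQ aB.
have T0 : 0 < (size F)%:R :> R by rewrite ltr0n lt0n size_eq0.
have QT0 : 0 < Q * (size F)%:R by rewrite mulr_gt0.
rewrite -(ler_pM2l T0).
have cst (t : R) : \sum_(z <- F) t = (size F)%:R * t.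
  by rewrite big_const_seq count_predT iter_addr addr0 mulr_natl.
(* one projection: concavity of the logarithm over the pieces *)
have one i : \sum_(z <- F) (ln (a i z)%:R - ln (c i z)%:R) <=
    (size F)%:R * (ln (u i)%:R - ln (size F)%:R) :> R.
  have ui0 : 0 < (u i)%:R :> R by rewrite ltr0n.
  have ac z : z \in F -> 0 < (a i z)%:R :> R /\ 0 < (c i z)%:R :> R.
    by move=> zF; rewrite !ltr0n; exact/andP/ac0.
  have -> : \sum_(z <- F) (ln (a i z)%:R - ln (c i z)%:R) =
      \sum_(z <- F) ln ((a i z)%:R / (c i z)%:R) :> R.
    by apply: eq_big_seq => z /ac[az cz]; rewrite ln_div ?posrE.
  rewrite -ln_div ?posrE//; apply: sum_ln_le; first by rewrite divr_gt0.
    by move=> z /ac[az cz]; rewrite divr_gt0.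
  by rewrite mulrC divfK ?gt_eqF.
(* one piece: concavity of the logarithm over the projections *)
have mult z : z \in F -> \sum_i ln (c i z)%:R <= #|I|%:R * ln (Q * (size F)%:R).
  move=> zF; have := @sum_ln_le R I (index_enum I) (fun i => (c i z)%:R) _ QT0.
  have -> : size (index_enum I) = #|I|.
    by rewrite -sum1_size -sum1_card; apply: eq_bigl.
  apply.
    by move=> i _; case/andP: (ac0 i z zF) => _; rewrite ltr0n.
  exact: cQ.
have : \sum_i \sum_(z <- F) (ln (a i z)%:R - ln (c i z)%:R) <=
    \sum_i (size F)%:R * (ln (u i)%:R - ln (size F)%:R) :> R.
  by apply: ler_sum => i _; exact: one.
have -> : \sum_i (size F)%:R * (ln (u i)%:R - ln (size F)%:R) =
    (size F)%:R * (\sum_i ln (u i)%:R - #|I|%:R * ln (size F)%:R) :> R.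
  by rewrite -mulr_sumr sumrB sumr_const (mulr_natl (ln (size F)%:R) #|I|).
rewrite exchange_big/= => h.
have : (size F)%:R * (B - #|I|%:R * ln (Q * (size F)%:R)) <=
    \sum_(z <- F) \sum_i (ln (a i z)%:R - ln (c i z)%:R).
  rewrite -cst big_seq [leRHS]big_seq; apply: ler_sum => z zF.
  by rewrite sumrB lerB ?aB ?mult.
move=> /le_trans/(_ h); rewrite lnM ?posrE//.
by rewrite !mulrBr mulrDr; move: #|I|%:R => k; lra.
Qed.

Lemma card_le_spread (M D : nat) (S : {set 'I_M}) :
  {in S &, forall i j : 'I_M, (i <= j + D)%N} -> (#|S| <= D.+1)%N.
Proof.
move=> SD; have [->|/set0Pn[i iS]] := eqVneq S finset.set0; first by rewrite cards0.
case: (arg_minnP val iS) => i0 i0S i0min.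
rewrite cardE -(size_map val) -(size_iota i0 D.+1).
apply: uniq_leq_size; first by rewrite map_inj_uniq ?enum_uniq//; exact: val_inj.
move=> k /mapP[j]; rewrite mem_enum => jS ->.
by rewrite mem_iota i0min//= addnS ltnS SD.
Qed.

(** If [n] is the length of [(d1, d2)], a proportion of order [tau / n] of the
    slopes is almost orthogonal to that vector. *)
Lemma card_small_slopes (R : realType) (M : nat) (d1 d2 n tau : R) :
  0 < n -> n <= `|d1| + `|d2| -> 0 < tau -> (0 < M)%N ->
  #|[set i : 'I_M | `|d1 + i%:R / M%:R * d2| <= tau]%SET|%:R <= 1 + 8 * tau * M%:R / n.
Proof.
move=> n0 nd tau0 M0; have M0' : 0 < M%:R :> R by rewrite ltr0n.
set S := [set i : 'I_M | _]%SET; have [d2n|d2n] := ltP `|d2| (n / 4).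
  (* the vector is nearly horizontal, so all the values are at least n / 2 *)
  have [->|/set0Pn[i]] := eqVneq S finset.set0.
    by rewrite cards0 addr_ge0// divr_ge0 ?mulr_ge0// ltW.
  rewrite inE => di; have n2tau : n / 2 <= tau.
    have i1 : 0 <= (i%:R / M%:R : R) <= 1.
      by rewrite divr_ge0//= ler_pdivrMr// mul1r ler_nat ltnW.
    have : `|i%:R / M%:R * d2| <= `|d2|.
      by rewrite normrM ger0_norm ?ler_piMl//; case/andP: i1.
    have := lerB_normD d1 (i%:R / M%:R * d2); lra.
  apply: (@le_trans _ _ M%:R).
    by rewrite ler_nat (leq_trans (max_card _))// card_ord.
  rewrite -[leLHS]add0r lerD// ler_pdivlMr// mulrC ler_pM2r//; lra.
pose D := Num.truncn (8 * tau * M%:R / n).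
have y0 : 0 <= 8 * tau * M%:R / n by rewrite divr_ge0 ?mulr_ge0// ltW.
apply: (@le_trans _ _ D.+1%:R); last first.
  by rewrite -natr1 addrC lerD2l truncn_le.
rewrite ler_nat; apply: card_le_spread => i j; rewrite !inE => di dj.
rewrite -leq_subLR truncn_ge_nat//.
have [ij|/ltnW ji] := leqP i j; first by have -> : (i - j = 0)%N by lia.
rewrite natrB// ler_pdivlMr//.
have d20 : 0 < `|d2| by lra.
have : `|(i%:R - j%:R) / M%:R * d2| <= 2 * tau.
  have -> : (i%:R - j%:R) / M%:R * d2 = (d1 + i%:R / M%:R * d2) - (d1 + j%:R / M%:R * d2) by ring.
  by apply: le_trans (ler_normB _ _) _; lra.
rewrite !normrM ger0_norm ?subr_ge0 ?ler_nat// gtr0_norm ?invr_gt0//.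
rewrite mulrAC ler_pdivrMr// => h.
have : (i%:R - j%:R) * (n / 4) <= (i%:R - j%:R) * `|d2|.
  by rewrite ler_wpM2l// subr_ge0 ler_nat.
lra.
Qed.

(** * Distances from pins in many directions *)

Section pinned_distances.
Context {R : realType} {V : normedModType R}.
Context (p1 p2 : V -> R).
Context (norm_le_coords : forall x y,
  `|x - y| <= `|p1 x - p1 y| + `|p2 x - p2 y|).

(** Kaufman's averaging argument: up to constants, a point at distance
    [2 ^ j * r / 2 ^ m] from [z] is confused with [z] for a proportion [2 ^ - j]
    of the slopes, and a fraction [A * 2 ^ j / 2 ^ m] of the points is that
    close, so that each of the [m + 1] dyadic distances contributes
    [A / 2 ^ m]. *)
Lemma sum_card_close_slopes (F : seq V) (z : V) (A r : R) (m : nat)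
    (S : V -> {set 'I_(2 ^ m)}) :
  0 < r ->
  (forall u, 1 <= u -> (count (fun z' => `|z - z'| <= u / 2 ^+ m * r) F)%:R <=
     A * u / 2 ^+ m * (size F)%:R) ->
  {in F, forall z', `|z - z'| <= r} ->
  {in F, forall z' (i : 'I_(2 ^ m)), i \in S z' ->
     `|(p1 z - p1 z') + i%:R / 2 ^+ m * (p2 z - p2 z')| <= 19 * (r / 2 ^+ m)} ->
  \sum_(z' <- F) #|S z'|%:R <=
    2 ^+ m * (306 * A * m.+1%:R / 2 ^+ m * (size F)%:R) :> R.
Proof.
move=> r0 Fu Fr FS; have pw_gt0 k : 0 < 2 ^+ k :> R by rewrite exprn_gt0.
have rho0 : 0 < r / 2 ^+ m by rewrite divr_gt0.
pose near j z' := `|z - z'| <= 2 ^+ j.+1 / 2 ^+ m * r.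
have pointwise z' : z' \in F ->
    #|S z'|%:R <= \sum_(j < m.+1) 153 * 2 ^+ m / 2 ^+ j * (near j z')%:R :> R.
  move=> z'F; have near_m : near m z'.
    rewrite /near exprS mulfK ?gt_eqF//; apply: le_trans (Fr z' z'F) _; lra.
  (* the dyadic scale of the distance from [z] to [z'] *)
  case: (ex_minnP (ex_intro (near^~ z') m near_m)) => j near_j minj.
  have jm : (j < m.+1)%N by rewrite ltnS minj.
  rewrite (bigD1 (Ordinal jm))//= near_j mulr1.
  apply: ler_wpDr.
    by apply: sumr_ge0 => i _; rewrite mulr_ge0// divr_ge0 ?mulr_ge0// ltW.
  case: j near_j minj {jm} => [|j] near_j minj.
    apply: (@le_trans _ _ (2 ^+ m)); last by rewrite expr0 divr1 ler_peMl ?ltW//; lra.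
    by rewrite -natrX ler_nat (leq_trans (max_card _))// card_ord.
  have far_j : 2 ^+ j.+1 / 2 ^+ m * r < `|z - z'|.
    by rewrite ltNge; apply/negP => /minj; rewrite ltnn.
  have n0 : 0 < `|z - z'| by apply: lt_trans far_j; rewrite mulr_gt0 ?divr_gt0.
  pose tau := 19 * (r / 2 ^+ m); have tau0 : 0 < tau by rewrite mulr_gt0.
  have M0 : (0 < 2 ^ m)%N by rewrite expn_gt0.
  have := card_small_slopes n0 (norm_le_coords z z') tau0 M0.
  rewrite natrX => card_le; apply: (@le_trans _ _ (1 + 8 * tau * 2 ^+ m / `|z - z'|)).
    apply: le_trans card_le; rewrite ler_nat; apply: subset_leq_card.
    by apply/fintype.subsetP => i /(FS z' z'F i); rewrite inE.
  have -> : 8 * tau * 2 ^+ m = 152 * r by rewrite /tau; field; rewrite gt_eqF.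
  apply: (@le_trans _ _ (153 * r / `|z - z'|)).
    rewrite -[X in X + _](@divff _ `|z - z'|) ?gt_eqF// -mulrDl ler_pM2r ?invr_gt0//.
    have := Fr z' z'F; lra.
  rewrite ler_pdivrMr//.
  have -> : 153 * r = 153 * 2 ^+ m / 2 ^+ j.+1 * (2 ^+ j.+1 / 2 ^+ m * r).
    by field; rewrite !gt_eqF.
  by rewrite ler_pM2l ?divr_gt0 ?mulr_gt0// ltW.
apply: (@le_trans _ _
    (\sum_(z' <- F) \sum_(j < m.+1) 153 * 2 ^+ m / 2 ^+ j * (near j z')%:R)).
  by rewrite big_seq [leRHS]big_seq; apply: ler_sum.
rewrite exchange_big /=.
have -> : 2 ^+ m * (306 * A * m.+1%:R / 2 ^+ m * (size F)%:R) =
    \sum_(j < m.+1) 306 * A * (size F)%:R.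
  by rewrite sumr_const card_ord -mulr_natr; field; rewrite gt_eqF.
apply: ler_sum => j _; rewrite -mulr_sumr.
have -> : \sum_(z' <- F) (near j z')%:R = (count (near j) F)%:R :> R.
  rewrite -sum1_count [in RHS]big_mkcond natr_sum; apply: eq_bigr => z' _.
  by case: (near j z').
have u1 : 1 <= 2 ^+ j.+1 :> R by rewrite exprn_ege1// ler1n.
have := Fu (2 ^+ j.+1) u1 => h.
have c0 : 0 < 153 * 2 ^+ m / 2 ^+ j :> R by rewrite divr_gt0 ?mulr_gt0.
apply: (@le_trans _ _ (153 * 2 ^+ m / 2 ^+ j * (A * 2 ^+ j.+1 / 2 ^+ m * (size F)%:R))).
  by rewrite ler_pM2l.
by rewrite le_eqVlt exprS; apply/orP; left; apply/eqP; field; rewrite !gt_eqF.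
Qed.

(** The hypothesis on the slopes holds on the whole ball with the same error, so
    that one step of [sum_ln_branching] can be repeated in each of the smaller
    balls, down to the scale [delta], with the same projections [f i]. *)
Lemma sum_ln_cells_ge (E : set V) (A r0 R1 : R) (z0 : V) (m J : nat)
    (f : 'I_(2 ^ m) -> V -> R) (delta : R) :
  evenly_spread E A r0 -> 0 < A -> (0 < m)%N -> 0 < delta ->
  (forall i x y, `|f i x - f i y| <= `|x - y|) ->
  (forall i x, 0 <= f i x) ->
  (forall i x, `|z0 - x| <= R1 -> f i x < J%:R * delta) ->
  (forall (i : 'I_(2 ^ m)) x y, E x -> E y -> `|z0 - x| <= R1 -> `|z0 - y| <= R1 ->
    `|(p1 x - p1 y) + i%:R / 2 ^+ m * (p2 x - p2 y)| <=
      6 * `|f i x - f i y| + `|x - y| / 2 ^+ m) ->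
  forall n y r, E y -> 0 < r <= r0 -> `|z0 - y| + r <= R1 ->
    r = delta * (2 ^+ m) ^+ n ->
  - (2 ^+ m * n%:R * ln (306 * A * m.+1%:R / 2 ^+ m)) <=
    \sum_i ln #|cells J delta (f i @` [set x | E x /\ `|y - x| <= r])|%:R.
Proof.
move=> spread A0 m0 delta0 f_lip f_ge0 f_lt f_slope.
have pw_gt0 k : 0 < 2 ^+ k :> R by rewrite exprn_gt0.
set Q := 306 * A * _ / _; have Q0 : 0 < Q by rewrite divr_gt0 ?mulr_gt0 ?ltr0n.
pose fcells i y r := cells J delta (f i @` [set x | E x /\ `|y - x| <= r]).
have fcells_gt0 i y r : E y -> 0 < r -> `|z0 - y| + r <= R1 ->
    (0 < #|fcells i y r|)%N.
  move=> Ey r_0 yr; have ytr : (Num.truncn (f i y / delta) < J)%N.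
    rewrite truncn_lt_nat ?divr_ge0 ?(ltW delta0)// ltr_pdivrMr// f_lt//; lra.
  apply/card_gt0P; exists (Ordinal ytr); rewrite inE; apply/asboolP.
  by exists (f i y) => //; exists y => //; split => //; rewrite subrr normr0 ltW.
elim=> [|n IH] y r Ey /andP[r_0 rr0] yr rE.
  rewrite mulr0 mul0r oppr0; apply: sumr_ge0 => i _.
  by rewrite ln_ge0// ler1n fcells_gt0.
have rho01 : 0 < ((2 ^+ m)^-1 : R) < 1.
  rewrite invr_gt0 pw_gt0/= invf_lt1//; case: (m) m0 => // m' _.
  by rewrite exprn_egt1// ltr1n.
have [F [F0 FE Fc]] := spread y r _ Ey (introT andP (conj r_0 rr0)) rho01.
pose kappa := r / 2 ^+ m; have kappa0 : 0 < kappa by rewrite divr_gt0.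
have kappaE : kappa = delta * (2 ^+ m) ^+ n by rewrite /kappa rE exprS; field; rewrite gt_eqF.
have delta_kappa : delta <= kappa.
  by rewrite kappaE ler_peMr ?(ltW delta0)// exprn_ege1// exprn_ege1// ler1n.
have kappa_half : kappa <= r / 2.
  rewrite /kappa ler_pM2l// lef_pV2 ?posrE// -natrX ler_nat.
  by case: (m) m0 => // m' _; rewrite expnS leq_pmulr// expn_gt0.
have F_in z : z \in F -> `|z0 - z| + kappa <= R1.
  by move=> /FE[_ zy]; have := ler_distD y z0 z; lra.
have F_r z z' : z \in F -> z' \in F -> `|z - z'| <= r.
  move=> /FE[_ zy] /FE[_ z'y]; have := ler_distD y z z'; rewrite [`|z - y|]distrC; lra.
(* The balls of radius [kappa] around [z] and [z'] can share a cell, whose size is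
   at most [kappa], only if the values at [z] and [z'] are within [3 * kappa]. *)
pose c (i : 'I_(2 ^ m)) z := count (fun z' => `|f i z - f i z'| <= 3 * kappa) F.
have := @sum_ln_branching R V _ F (fun i z => #|fcells i z kappa|) c
  (fun i => #|fcells i y r|) Q (- (2 ^+ m * n%:R * ln Q)) F0 Q0.
rewrite card_ord natrX => step; apply: le_trans (step _ _ _ _ _); clear step.
- by rewrite -natr1; lra.
- by move=> i; apply: fcells_gt0.
- move=> i z zF; have [Ez _] := FE z zF; rewrite fcells_gt0 ?F_in//=.
  by rewrite -has_count; apply/hasP; exists z; rewrite // subrr normr0 mulr_ge0// ltW.
- move=> i; apply: sum_card_div_multiplicity => z zF.
    apply/fintype.subsetP => j; rewrite !inE => -[a [x [Ex xz] fx] aj].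
    exists a => //; exists x => //; split => //.
    have [_ yz] := FE z zF; have := ler_distD z y x; lra.
  move=> j jz; apply: le_count_in => z' z'F; rewrite !inE in jz *.
  move=> [a' [x' [Ex' x'z'] fx'] x'j].
  move: jz => [a [x [Ex xz] fx] xj].
  rewrite -{}fx' in x'j; rewrite -{}fx in xj.
  have fxx' : `|f i x - f i x'| <= delta.
    have /andP[a1 b1] : j%:R <= f i x / delta < j.+1%:R.
      by rewrite -xj truncn_itv// divr_ge0// ltW.
    have /andP[a2 b2] : j%:R <= f i x' / delta < j.+1%:R.
      by rewrite -x'j truncn_itv// divr_ge0// ltW.
    move: a1 b1 a2 b2; rewrite !ler_pdivlMr// !ltr_pdivrMr// -natr1 => a1 b1 a2 b2.
    rewrite ler_norml; apply/andP; split; lra.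
  have := f_lip i z x; have := f_lip i z' x'.
  have := ler_distD (f i x) (f i z) (f i z').
  have := ler_distD (f i x') (f i x) (f i z').
  rewrite [`|f i x' - f i z'|]distrC; lra.
- move=> z zF; have [Ez _] := FE z zF.
  pose S z' : {set 'I_(2 ^ m)} := [set i : 'I__ | `|f i z - f i z'| <= 3 * kappa]%SET.
  have -> : \sum_i (c i z)%:R = \sum_(z' <- F) #|S z'|%:R :> R.
    rewrite -!natr_sum; congr (_%:R).
    under eq_bigr do rewrite /c -sum1_count big_mkcond.
    rewrite exchange_big; apply: eq_bigr => z' _ /=.
    by rewrite -sum1_card [RHS]big_mkcond; apply: eq_bigr => i _; rewrite inE.
  apply: (@sum_card_close_slopes F z A r m S r_0).
  + by move=> u u1; have := Fc z zF u u1.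
  + by move=> z' z'F; exact: F_r.
  + move=> z' z'F i; rewrite inE => close.
    have [Ez' _] := FE z' z'F.
    have zR : `|z0 - z| <= R1 by have := F_in z zF; lra.
    have z'R : `|z0 - z'| <= R1 by have := F_in z' z'F; lra.
    apply: le_trans (f_slope i z z' Ez Ez' zR z'R) _.
    have : `|z - z'| / 2 ^+ m <= kappa by rewrite ler_pM2r ?invr_gt0// F_r.
    rewrite -/kappa; lra.
- move=> z zF; have [Ez _] := FE z zF; apply: IH => //; last exact: F_in.
  by rewrite kappa0/=; lra.
Qed.

End pinned_distances.

(** * Pins in the plane *)

Section plane.
Context {R : realType}.
Implicit Types (x y : euclidean R 2) (E : set (euclidean R 2)).

Definition px x : R := (x : 'rV[R]_2) 0 0.
Definition py x : R := (x : 'rV[R]_2) 0 1.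

Lemma pxB x y : px (x - y) = px x - px y.
Proof. by rewrite /px !mxE. Qed.

Lemma pyB x y : py (x - y) = py x - py y.
Proof. by rewrite /py !mxE. Qed.

Lemma norm_plane_sqr x : `|x| ^+ 2 = px x ^+ 2 + py x ^+ 2.
Proof.
rewrite [LHS](enorm_sqr x) !big_ord_recl big_ord0 addr0.
by congr (_ + (_ : 'rV[R]_2) _ _ ^+ 2); apply/val_inj.
Qed.

Lemma normr_px_le x : `|px x| <= `|x|.
Proof.
rewrite -(@ler_pXn2r _ 2)// ?nnegrE// norm_plane_sqr real_normK ?num_real//.
by rewrite lerDl sqr_ge0.
Qed.

Lemma normr_py_le x : `|py x| <= `|x|.
Proof.
rewrite -(@ler_pXn2r _ 2)// ?nnegrE// norm_plane_sqr real_normK ?num_real//.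
by rewrite lerDr sqr_ge0.
Qed.

Lemma norm_plane_le x y : `|x - y| <= `|px x - px y| + `|py x - py y|.
Proof.
rewrite -pxB -pyB; move: (x - y) => {x y}z.
rewrite -(@ler_pXn2r _ 2)// ?nnegrE ?addr_ge0// norm_plane_sqr sqrrD.
rewrite !real_normK ?num_real// lerD2r lerDl.
by rewrite mulrn_wge0// mulr_ge0.
Qed.

Lemma plane_separable : exists q : nat -> euclidean R 2,
  forall x (e : R), 0 < e -> exists n, `|x - q n| < e.
Proof.
pose pt (ab : rat * rat) : euclidean R 2 :=
  \row_(j < 2) if j == 0 then ratr ab.1 else ratr ab.2 : R.
exists (fun n => if unpickle n is Some ab then pt ab else 0) => x e e0.
have e20 : 0 < e / 2 by rewrite divr_gt0.
have approx (a : R) : exists b : rat, `|a - ratr b| < e / 2.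
  have [b] := @rat_in_itvoo R (a - e / 2) (a + e / 2) ltac:(lra).
  rewrite in_itv/= => /andP[b1 b2]; exists b; rewrite ltr_norml; apply/andP; split; lra.
have [a ha] := approx (px x); have [b hb] := approx (py x).
exists (pickle (a, b)); rewrite pickleK.
apply: le_lt_trans (norm_plane_le _ _) _.
have -> : px (pt (a, b)) = ratr a by rewrite /px mxE.
have -> : py (pt (a, b)) = ratr b by rewrite /py mxE.
lra.
Qed.

(** Near [y], the differences of squared distances to [x] are governed by the
    inner product with [x - y], a vector that is almost proportional to
    [(1, sigma)]. *)
Lemma pinned_distance_slope x y y1 y2 (sigma rho : R) :
  0 <= sigma <= 1 -> 0 < rho <= 1 -> x != y ->
  `|(py x - py y) - sigma * (px x - px y)| <= rho / 2 * `|px x - px y| ->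
  `|y - y1| <= rho / 12 * `|x - y| -> `|y - y2| <= rho / 12 * `|x - y| ->
  `|(px y1 - px y2) + sigma * (py y1 - py y2)| <=
    6 * `| `|x - y1| - `|x - y2| | + rho * `|y1 - y2|.
Proof.
move=> /andP[sigma0 sigma1] /andP[rho0 rho1] xy slope near1 near2.
set w := x - y; set w1 := px x - px y in slope *; set w2 := py x - py y in slope *.
have w0 : 0 < `|w| by rewrite normr_gt0 subr_eq0.
have ww1 : `|w| <= 3 * `|w1|.
  apply: le_trans (norm_plane_le x y) _; rewrite -/w1 -/w2.
  have -> : w2 = (w2 - sigma * w1) + sigma * w1 by rewrite subrK.
  have := ler_normD (w2 - sigma * w1) (sigma * w1).
  rewrite [`|sigma * w1|]normrM (ger0_norm sigma0).
  have := ler_wpM2r (normr_ge0 w1) sigma1; have := ler_wpM2r (normr_ge0 w1) rho1.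
  have := normr_ge0 w1; nra.
have w10 : 0 < `|w1| by lra.
pose d1 := px y1 - px y2; pose d2 := py y1 - py y2; pose d := `|y1 - y2|.
have d1d : `|d1| <= d by rewrite /d1 -pxB normr_px_le.
have d2d : `|d2| <= d by rewrite /d2 -pyB normr_py_le.
have d0 : 0 <= d by exact: normr_ge0.
pose e1 := (px y - px y1) + (px y - px y2).
pose e2 := (py y - py y1) + (py y - py y2).
have e1e : `|e1| <= rho / 6 * `|w|.
  rewrite /e1 -!pxB; apply: le_trans (ler_normD _ _) _.
  have := normr_px_le (y - y1); have := normr_px_le (y - y2); rewrite -/w in near1 near2; lra.
have e2e : `|e2| <= rho / 6 * `|w|.
  rewrite /e2 -!pyB; apply: le_trans (ler_normD _ _) _.
  have := normr_py_le (y - y1); have := normr_py_le (y - y2); rewrite -/w in near1 near2; lra.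
pose f1 := `|x - y1|; pose f2 := `|x - y2|; pose X := `|d1 + sigma * d2|.
(* difference of squared distances, expanded around the direction of [w] *)
have sqr_diff : (f1 - f2) * (f1 + f2) =
    - (2 * w1 * (d1 + sigma * d2) + 2 * d2 * (w2 - sigma * w1) + (d1 * e1 + d2 * e2)).
  have -> : (f1 - f2) * (f1 + f2) = f1 ^+ 2 - f2 ^+ 2 by rewrite subr_sqr.
  rewrite !norm_plane_sqr !pxB !pyB /d1 /d2 /e1 /e2 /w1 /w2; ring.
have sum_le : f1 + f2 <= 3 * `|w|.
  have := ler_distD y x y1; have := ler_distD y x y2; rewrite -/f1 -/f2 -/w.
  rewrite -/w in near1 near2; have := ler_wpM2r (normr_ge0 w) rho1; lra.
have f0 : 0 <= f1 + f2 by apply: addr_ge0; exact: normr_ge0.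
have lower : 2 * `|w1| * X - rho * `|w1| * d - rho / 3 * `|w| * d <=
    `|f1 - f2| * (f1 + f2).
  rewrite -(ger0_norm f0) -normrM sqr_diff normrN.
  have -> : 2 * `|w1| * X = `|2 * w1 * (d1 + sigma * d2)|.
    by rewrite !normrM /X ger0_norm.
  have h1 : `|2 * d2 * (w2 - sigma * w1)| <= rho * `|w1| * d.
    rewrite !normrM ger0_norm//.
    have := ler_pM (normr_ge0 _) (normr_ge0 _) d2d slope; lra.
  have h2 : `|d1 * e1 + d2 * e2| <= rho / 3 * `|w| * d.
    apply: le_trans (ler_normD _ _) _; rewrite !normrM.
    have := ler_pM (normr_ge0 _) (normr_ge0 _) d1d e1e.
    have := ler_pM (normr_ge0 _) (normr_ge0 _) d2d e2e; lra.
  set u := 2 * w1 * _ in h1 *; set v := 2 * d2 * _ in h1 *.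
  set t := d1 * e1 + _ in h2 *.
  have := lerB_normD (u + v) t; have := lerB_normD u v; lra.
have upper : `|f1 - f2| * (f1 + f2) <= 9 * `|w1| * `|f1 - f2|.
  rewrite mulrC ler_wpM2r//; lra.
have wd : rho / 3 * `|w| * d <= rho * `|w1| * d.
  by rewrite ler_wpM2r//; have := ler_wpM2l (ltW rho0) ww1; lra.
have : 2 * `|w1| * X <= `|w1| * (9 * `|f1 - f2| + 2 * rho * d) by lra.
rewrite -mulrA mulrCA ler_pM2l// => main.
rewrite -/d1 -/d2 -/X -/f1 -/f2 -/d; have := normr_ge0 (f1 - f2); lra.
Qed.

End plane.

Section plane_sets.
Context {R : realType}.
Implicit Types (E : set (euclidean R 2)).

(** A pin stays good on smaller balls, so the pins can be chosen one after the
    other in shrinking balls: of the two points found for a new slope, the first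
    becomes the pin and the second the centre of the next ball. *)
Lemma exists_common_pins E (M : nat) (sigma : nat -> R) (rho r0 : R) y0 :
  E y0 -> 0 < r0 -> 0 < rho <= 1 ->
  (forall i, (i < M)%N -> 0 <= sigma i <= 1) ->
  (forall i y r, (i < M)%N -> E y -> 0 < r <= r0 -> exists x x',
    [/\ E x, E x', `|y - x'| <= r & x != x' /\
      `|(py x - py x') - sigma i * (px x - px x')| <=
         rho / 2 * `|px x - px x'|]) ->
  exists (pin : nat -> euclidean R 2) z0 R1, [/\ E z0, 0 < R1 <= r0,
    forall i, (i < M)%N -> E (pin i) &
    forall i y1 y2, (i < M)%N -> `|z0 - y1| <= R1 -> `|z0 - y2| <= R1 ->
      `|(px y1 - px y2) + sigma i * (py y1 - py y2)| <=
      6 * `| `|pin i - y1| - `|pin i - y2| | + rho * `|y1 - y2|].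
Proof.
move=> Ey0 r00 rho01 sigma01 dense; have /andP[rho0 rho1] := rho01.
elim: M sigma01 dense => [|M IH] sigma01 dense.
  by exists (fun=> y0), y0, r0; split => //; rewrite r00 lexx.
have [i iM|i y r iM|pin [z0 [R1 [Ez0 /andP[R10 R1r0] Epin slope]]]] := IH.
- exact/sigma01/ltnW.
- exact/dense/ltnW.
have [|x [x' [Ex Ex' zx' [xx' xslope]]]] := dense M z0 (R1 / 2) (ltnSn M) Ez0.
  by apply/andP; split; lra.
have w0 : 0 < `|x - x'| by rewrite normr_gt0 subr_eq0.
pose R2 := Num.min (R1 / 2) (rho / 12 * `|x - x'|).
have R20 : 0 < R2 by rewrite lt_min !mulr_gt0 ?divr_gt0// invr_gt0.
have [R2R1 R2w] : R2 <= R1 / 2 /\ R2 <= rho / 12 * `|x - x'|.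
  by split; rewrite ge_min lexx ?orbT.
exists (fun i => if i == M then x else pin i), x', R2; split => //.
- by apply/andP; split => //; lra.
- by move=> i; rewrite ltnS leq_eqVlt; case: eqP => //= _ /Epin.
move=> i y1 y2; rewrite ltnS leq_eqVlt => iM y1R y2R; case: eqP iM => [->|_ /= iM].
  move=> _; apply: pinned_distance_slope (sigma01 M (ltnSn M)) rho01 xx' xslope _ _.
    exact: le_trans y1R R2w.
  exact: le_trans y2R R2w.
apply: slope => //.
  by have := ler_distD x' z0 y1; lra.
by have := ler_distD x' z0 y2; lra.
Qed.

(** The gain [ln (2 ^ m)] of a step beats its loss, which is logarithmic in
    [m]. *)
Lemma exists_large_scale_count (A eps : R) : 0 < A -> 0 < eps ->
  exists m, (0 < m)%N /\
    ln (306 * A * m.+1%:R / 2 ^+ m) <= - (1 - eps) * (m%:R * ln 2).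
Proof.
move=> A0 eps0; have ln20 : 0 < ln 2 :> R by rewrite ln_gt0// ltr1n.
pose b : R := 2 / (eps * ln 2); have b0 : 0 < b by rewrite divr_gt0 ?mulr_gt0.
pose C := ln (306 * A) + ln b + b^-1.
pose m := (Num.truncn (2 * C / (eps * ln 2))).+1.
exists m; split => //.
have mC : 2 * C < m%:R * (eps * ln 2).
  by rewrite -ltr_pdivrMr ?mulr_gt0// truncnS_gt.
have Am : 0 < 306 * A * m.+1%:R by rewrite !mulr_gt0 ?ltr0n.
rewrite ln_div ?posrE ?exprn_gt0// lnXn// -(mulr_natl (ln 2) m).
rewrite lnM ?posrE ?mulr_gt0 ?ltr0n//.
have tangent : ln m.+1%:R <= m.+1%:R / b - 1 + ln b.
  have -> : ln m.+1%:R = ln (m.+1%:R / b) + ln b.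
    by rewrite ln_div ?posrE ?ltr0n// subrK.
  have mb : 0 < m.+1%:R / b by rewrite divr_gt0 ?ltr0n.
  rewrite lerD2r -[in leLHS](subrK 1 (m.+1%:R / b)) addrC le_ln1Dx//; lra.
have mbE : m.+1%:R / b = m%:R * (eps * ln 2) / 2 + b^-1.
  by rewrite -natr1 mulrDl mul1r /b invf_div; field.
rewrite mbE in tangent; rewrite /C in mC; move: mC tangent; clear; lra.
Qed.

End plane_sets.

(** * Many distances at small scales *)

Lemma neg_ln_gt (R : realType) (T : R) :
  exists2 d1 : R, 0 < d1 & forall d, 0 < d < d1 -> T < - ln d.
Proof.
exists (expR (- T)); first exact: expR_gt0.
move=> d /andP[d0 dT]; rewrite ltrNr -(expRK (- T)) ltr_ln ?posrE//.
exact: expR_gt0.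
Qed.

Section distance_sets_in_the_plane.
Context {R : realType}.
Implicit Types (E : set (euclidean R 2)).

(** The linear form [t] vanishes on the missed slope, so it is bi-Lipschitz on
    the set.  The factor 3 is the number of cells that a ball can meet. *)
Lemma many_cells_of_missed_slope E (A r0 r sigma eta : R) y0 (eps : R) :
  evenly_spread E A r0 -> 0 < A -> E y0 -> 0 < r <= r0 ->
  0 <= sigma <= 1 -> 0 < eta ->
  (forall x x', E x -> E x' -> `|y0 - x| <= r -> `|y0 - x'| <= r -> x != x' ->
     eta * `|px x - px x'| < `|(py x - py x') - sigma * (px x - px x')|) ->
  0 < eps -> forall delta0 : R, 0 < delta0 -> exists delta M,
    0 < delta < delta0 /\
    (1 - eps) * - ln delta <= ln (#|cells M delta (distance_set E)|%:R / 3).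
Proof.
move=> spread A0 Ey0 rr0 /andP[sigma0 sigma1] eta0 missed eps0 delta0 delta00.
have /andP[r_0 _] := rr0.
pose t (x : euclidean R 2) := py x - sigma * px x.
have tB x y : t x - t y = (py x - py y) - sigma * (px x - px y) by rewrite /t; ring.
have t_lip x y : `|t x - t y| <= 2 * `|x - y|.
  rewrite tB; apply: le_trans (ler_normB _ _) _; rewrite normrM (ger0_norm sigma0).
  have := normr_px_le (x - y); have := normr_py_le (x - y); rewrite pxB pyB.
  by have := ler_wpM2r (normr_ge0 (px x - px y)) sigma1; lra.
pose L := 1 + 2 / eta; have L1 : 1 <= L by rewrite lerDl divr_ge0// ltW.
have [|c c0 many] := @graph_distance_cells R _ E A r0 r L y0 t spread A0 Ey0 rr0 L1 t_lip.
  move=> x x' Ex Ex' yx yx'; have [->|xx'] := eqVneq x x'.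
    by rewrite !subrr !normr0 mulr0.
  have yr (z : euclidean R 2) : `|y0 - z| <= r / 2 -> `|y0 - z| <= r by lra.
  have := missed x x' Ex Ex' (yr _ yx) (yr _ yx') xx'; rewrite -tB => px_le.
  apply: le_trans (norm_plane_le x x') _.
  have : `|py x - py x'| <= `|t x - t x'| + `|px x - px x'|.
    have -> : py x - py x' = (t x - t x') + sigma * (px x - px x') by rewrite tB subrK.
    apply: le_trans (ler_normD _ _) _; rewrite lerD2l normrM (ger0_norm sigma0).
    by rewrite ler_piMl.
  have : `|px x - px x'| <= `|t x - t x'| / eta by rewrite ler_pdivlMr// mulrC ltW.
  by rewrite /L mulrDl mul1r mulrAC; lra.
have c30 : 0 < c / 3 by rewrite divr_gt0.
have [d1 d10 lnd1] := neg_ln_gt (- ln (c / 3) / eps).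
have d0 : 0 < Num.min delta0 d1 by rewrite lt_min delta00.
have [delta [M [/andP[delta_gt0 ltd] card_ge]]] := many _ d0.
move: ltd; rewrite lt_min => /andP[delta_lt delta_d1].
exists delta, M; split; first by rewrite delta_gt0.
have := lnd1 delta (introT andP (conj delta_gt0 delta_d1)).
rewrite ltr_pdivrMr// => ln_delta.
have : ln (c / 3) - ln delta <= ln (#|cells M delta (distance_set E)|%:R / 3).
  rewrite -ln_div ?posrE// ler_ln ?posrE ?divr_gt0//.
    by rewrite mulrAC ler_pM2r ?invr_gt0.
  by apply: lt_le_trans card_ge; rewrite divr_gt0.
by lra.
Qed.

(** The mean over the pins of the logarithmic count is large at every scale
    [R1 / 2 ^ (m * n)], so at each of them it is large for some pin. *)
Lemma many_cells_of_common_pins E (A r0 R1 lambda : R) z0 (eps : R) (m : nat)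
    (pin : nat -> euclidean R 2) :
  evenly_spread E A r0 -> 0 < A -> E z0 -> 0 < R1 <= r0 -> (0 < m)%N ->
  (forall x y, E x -> E y -> `|x - y| <= lambda) ->
  (forall i, (i < 2 ^ m)%N -> E (pin i)) ->
  (forall i y1 y2, (i < 2 ^ m)%N -> `|z0 - y1| <= R1 -> `|z0 - y2| <= R1 ->
      `|(px y1 - px y2) + i%:R / 2 ^+ m * (py y1 - py y2)| <=
      6 * `| `|pin i - y1| - `|pin i - y2| | + (2 ^+ m)^-1 * `|y1 - y2|) ->
  0 < eps ->
  ln (306 * A * m.+1%:R / 2 ^+ m) <= - (1 - eps / 2) * (m%:R * ln 2) ->
  forall delta0 : R, 0 < delta0 -> exists delta M,
    0 < delta < delta0 /\
    (1 - eps) * - ln delta <= ln (#|cells M delta (distance_set E)|%:R / 3).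
Proof.
move=> spread A0 Ez0 /andP[R10 R1r0] m0 lambdaE Epin slope eps0 lnQ delta0 delta00.
have ln20 : 0 < ln 2 :> R by rewrite ln_gt0// ltr1n.
have mln2 : 0 < m%:R * ln 2 :> R by rewrite mulr_gt0// ltr0n.
have pw_gt0 k : 0 < 2 ^+ k :> R by rewrite exprn_gt0.
have [n1 n1lt] := exists_pow2_lt R1 delta00.
pose T := ln 3 - (1 - eps) * ln R1; pose a := eps / 2 * (m%:R * ln 2).
have a0 : 0 < a by rewrite mulr_gt0// divr_gt0.
pose n := maxn n1 (Num.truncn (T / a)).+1.
have n_n1 : (n1 <= n)%N by rewrite leq_maxl.
have Tn : T <= n%:R * a.
  rewrite -ler_pdivrMr// ltW// (lt_le_trans (truncnS_gt _))//.
  by rewrite ler_nat leq_maxr.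
have [delta deltaE delta_gt0] : exists2 d, d = R1 / (2 ^+ m) ^+ n & 0 < d.
  by exists (R1 / (2 ^+ m) ^+ n) => //; rewrite divr_gt0// exprn_gt0.
pose J := (Num.truncn ((lambda + R1) / delta)).+1.
exists delta, J; split.
  rewrite delta_gt0 deltaE/= (le_lt_trans _ n1lt)//.
  rewrite ler_pM2l// lef_pV2 ?posrE ?exprn_gt0// -exprM ler_weXn2l ?ler1n//.
  by rewrite (leq_trans n_n1)// leq_pmull.
pose f (i : 'I_(2 ^ m)) (x : euclidean R 2) := `|pin i - x|.
have := @sum_ln_cells_ge R _ px py norm_plane_le E A r0 R1 z0 m J f delta
  spread A0 m0 delta_gt0.
have f_lip i x y : `|f i x - f i y| <= `|x - y|.
  apply: le_trans (ler_dist_dist _ _) _.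
  by rewrite opprB addrC subrKA distrC.
have f_lt i x : `|z0 - x| <= R1 -> f i x < J%:R * delta.
  move=> zx; rewrite -ltr_pdivrMr//; apply: le_lt_trans (truncnS_gt _).
  rewrite ler_pM2r ?invr_gt0//; apply: le_trans (ler_distD z0 _ _) _.
  by apply: lerD zx; exact: lambdaE (Epin i (ltn_ord i)) Ez0.
have f_slope (i : 'I_(2 ^ m)) x y : E x -> E y -> `|z0 - x| <= R1 -> `|z0 - y| <= R1 ->
    `|(px x - px y) + i%:R / 2 ^+ m * (py x - py y)| <=
      6 * `|f i x - f i y| + `|x - y| / 2 ^+ m.
  by move=> _ _ zx zy; rewrite [`|x - y| / _]mulrC; exact: slope.
move=> /(_ f_lip (fun i x => normr_ge0 _) f_lt f_slope n z0 R1 Ez0).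
rewrite R10 R1r0 subrr normr0 add0r lexx deltaE divfK ?gt_eqF ?exprn_gt0//.
rewrite -deltaE => /(_ isT isT erefl) sum_ge.
pose S i := f i @` [set x | E x /\ `|z0 - x| <= R1].
pose t := n%:R * ((1 - eps / 2) * (m%:R * ln 2)).
have [i card_i] : exists i : 'I_(2 ^ m), t <= ln #|cells J delta (S i)|%:R.
  apply: contrapT => /forallNP small; move: sum_ge; apply/negP; rewrite -ltNge.
  apply: (@lt_le_trans _ _ (\sum_(i < 2 ^ m) t)).
    apply: ltr_sum => [|i _].
      by apply/hasP; exists (Ordinal (expn_gt0 2 m)); rewrite ?mem_index_enum.
    by rewrite ltNge; apply/negP/small.
  rewrite sumr_const card_ord -(mulr_natl t) natrX.
  set lQ := ln _ in lnQ *.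
  have -> : - (2 ^+ m * n%:R * lQ) = 2 ^+ m * (n%:R * - lQ) by ring.
  rewrite ler_pM2l// /t ler_wpM2l//; move: lnQ; clear; lra.
have card_le : (#|cells J delta (S i)| <=
    #|cells J delta (distance_set E)|)%N.
  apply: subset_leq_card; apply/fintype.subsetP => j; rewrite !inE.
  move=> [d [x [Ex _] fx] dj]; exists d => //; exists (pin i); first exact: Epin.
  by exists x.
have card0 : (0 < #|cells J delta (S i)|)%N.
  have fzJ : (Num.truncn (f i z0 / delta) < J)%N.
    rewrite truncn_lt_nat ?divr_ge0 ?normr_ge0 ?(ltW delta_gt0)// ltr_pdivrMr//.
    by apply: f_lt; rewrite subrr normr0 ltW.
  apply/card_gt0P; exists (Ordinal fzJ); rewrite inE; apply/asboolP.
  exists (f i z0) => //; exists z0 => //; split => //.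
  by rewrite subrr normr0 ltW.
have ln_le : ln #|cells J delta (S i)|%:R <=
    ln #|cells J delta (distance_set E)|%:R :> R.
  by rewrite ler_ln ?posrE ?ltr0n ?ler_nat// (leq_trans card0).
have ln_delta : ln delta = ln R1 - n%:R * (m%:R * ln 2).
  rewrite deltaE ln_div ?posrE ?exprn_gt0// -exprM lnXn//.
  by rewrite -(mulr_natl (ln 2)) mulnC natrM mulrA.
rewrite ln_div ?posrE ?ltr0n //; last exact: leq_trans card0 card_le.
rewrite ln_delta.
move: card_i ln_le Tn; rewrite /t /T /a; clear; lra.
Qed.

Lemma distance_set_many_cells E (A r0 : R) y0 (lambda eps : R) :
  evenly_spread E A r0 -> 0 < A -> 0 < r0 -> E y0 ->
  (forall x y, E x -> E y -> `|x - y| <= lambda) ->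
  0 < eps -> forall delta0 : R, 0 < delta0 -> exists delta M,
    0 < delta < delta0 /\
    (1 - eps) * - ln delta <= ln (#|cells M delta (distance_set E)|%:R / 3).
Proof.
move=> spread A0 r00 Ey0 lambdaE eps0.
have [m [m0 lnQ]] := exists_large_scale_count A0 (divr_gt0 eps0 (ltr0n R 2)).
have pw_gt0 k : 0 < 2 ^+ k :> R by rewrite exprn_gt0.
pose sigma (i : nat) : R := i%:R / 2 ^+ m; pose rho : R := (2 ^+ m)^-1.
have rho01 : 0 < rho <= 1.
  by rewrite invr_gt0 pw_gt0 invf_le1// exprn_ege1// ler1n.
have /andP[rho0 rho1] := rho01.
have sigma01 i : (i < 2 ^ m)%N -> 0 <= sigma i <= 1.
  move=> im; rewrite divr_ge0 ?(ltW (pw_gt0 _))//= ler_pdivrMr// mul1r.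
  by rewrite -natrX ler_nat ltnW.
have [dense|] := pselect (forall i y r, (i < 2 ^ m)%N -> E y -> 0 < r <= r0 ->
    exists x x', [/\ E x, E x', `|y - x'| <= r & x != x' /\
      `|(py x - py x') - sigma i * (px x - px x')| <=
         rho / 2 * `|px x - px x'|]).
  have [pin [z0 [R1 [Ez0 R1r0 Epin slope]]]] :=
    exists_common_pins Ey0 r00 rho01 sigma01 dense.
  exact: (many_cells_of_common_pins spread A0 Ez0 R1r0 m0 lambdaE Epin slope eps0 lnQ).
move=> /existsNP[i /existsNP[y /existsNP[r]]].
move=> /not_implyP[im /not_implyP[Ey /not_implyP[rr0 /forallNP no_pair]]].
apply: (many_cells_of_missed_slope spread A0 Ey rr0 (sigma01 i im) (divr_gt0 rho0 (ltr0n R 2)) _ eps0).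
move=> x x' Ex Ex' yx yx' xx'; rewrite ltNge; apply/negP => le_px.
by have /forallNP/(_ x') := no_pair x; apply.
Qed.

End distance_sets_in_the_plane.

(** * Covering numbers of sets of nonnegative numbers *)

Section covering_numbers.
Context {R : realType}.
Implicit Types (D : set R) (delta : R).

Lemma covering_numberP D delta n : ball_coverable D delta n ->
  ball_coverable D delta (covering_number D delta) /\
  (covering_number D delta <= n)%N.
Proof.
move=> Dn; have exn : exists n, `[< ball_coverable D delta n >].
  by exists n; exact/asboolP.
rewrite /covering_number; case: xgetP => [m _ [Dm minm]|].
  by split => //; exact: minm.
case: (ex_minnP exn) => m /asboolP Dm minm /(_ m)[]; split => // k Dk.
by apply: minm; exact/asboolP.
Qed.

Lemma ball_coverable_interval D (lambda delta : R) : 0 < delta ->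
  (forall d, D d -> 0 <= d <= lambda) ->
  ball_coverable D delta (Num.truncn (lambda / delta)).+1.
Proof.
move=> delta0 Dl; exists (fun j => (j : nat)%:R * delta) => d /Dl /andP[d0 dl].
have dj : (Num.truncn (d / delta) < (Num.truncn (lambda / delta)).+1)%N.
  by rewrite ltnS le_truncn// ler_pM2r ?invr_gt0.
exists (Ordinal dj) => //; rewrite closed_ballE// /closed_ball_/=.
have /andP[lo hi] : (Num.truncn (d / delta))%:R <= d / delta
    < (Num.truncn (d / delta)).+1%:R by rewrite truncn_itv// divr_ge0// ltW.
move: lo hi; rewrite ler_pdivlMr// ltr_pdivrMr// -natr1 => lo hi.
rewrite ler_norml; apply/andP; split; lra.
Qed.

Lemma card_cells_le_coverable D delta M n : 0 < delta ->
  (forall d, D d -> 0 <= d) -> ball_coverable D delta n ->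
  (#|cells M delta D| <= n * 3)%N.
Proof.
move=> delta0 D0 [c Dc].
(* the first of the three cells that the ball of centre [c i] can meet *)
pose b i := Num.truncn (Num.max 0 (c i / delta - 1)).
pose g (ik : 'I_n * 'I_3) : nat := (b ik.1 + ik.2)%N.
have -> : (n * 3 = #|{: 'I_n * 'I_3}|)%N by rewrite card_prod !card_ord.
rewrite cardE -(size_map val) cardT -(size_map g).
apply: uniq_leq_size; first by rewrite map_inj_uniq ?enum_uniq//; exact: val_inj.
move=> k /mapP[j]; rewrite mem_enum inE => /asboolP[d Dd dj] ->{k}.
have [i _] := Dc d Dd; rewrite closed_ballE// /closed_ball_/= => cd.
have d0 : 0 <= d / delta by rewrite divr_ge0 ?(ltW delta0)// D0.
have lo : (b i <= j)%N.
  rewrite -dj le_truncn// ge_max d0/= lerBlDr ler_pdivrMr// mulrDl divfK ?gt_eqF//.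
  by have := ler_norm (c i - d); lra.
have hi : (j < b i + 3)%N.
  rewrite -dj truncn_lt_nat// ltr_pdivrMr//.
  have := truncnS_gt (Num.max 0 (c i / delta - 1)); rewrite gt_max => /andP[_].
  rewrite ltrBlDr ltr_pdivrMr// natrD -natr1 -/(b i).
  have := ler_norm (d - c i); rewrite distrC; lra.
have ji : (j - b i < 3)%N by lia.
apply/mapP; exists (i, Ordinal ji); first by rewrite mem_enum.
by rewrite /g/= subnKC.
Qed.

Lemma upper_box_dim_le1 D (lambda : R) : D !=set0 ->
  (forall d, D d -> 0 <= d <= lambda) -> (upper_box_dim D <= 1)%E.
Proof.
move=> [d0 Dd0] Dl; apply/lee_addgt0Pr => eps eps0.
have lambda0 : 0 <= lambda by have /andP[] := Dl _ Dd0; exact: le_trans.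
have lambda1 : 0 < lambda + 1 by lra.
have [d1 d10 lnd1] := neg_ln_gt (ln (lambda + 1) / eps).
have [d2 d20 lnd2] := neg_ln_gt (0 : R).
pose e := Num.min (Num.min d1 d2) 1.
have e0 : 0 < e by rewrite !lt_min d10 d20 ltr01.
apply: (@le_trans _ _ (ereal_sup ((fun delta : R =>
    (ln (covering_number D delta)%:R / (- ln delta))%:E) @` [set d | 0 < d < e]))).
  apply: ereal_inf_lbound; exists [set d | 0 < d < e] => //.
  near=> d; apply/andP; split; near: d; first exact: nbhs_right_gt.
  exact: nbhs_right_lt.
apply: ge_ereal_sup => _ [d /andP[d_gt0 de] <-].
move: de; rewrite !lt_min -andbA => /and3P[dd1 dd2 dlt1].
have ln_d := lnd1 d (introT andP (conj d_gt0 dd1)).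
have lnd0 := lnd2 d (introT andP (conj d_gt0 dd2)).
rewrite lee_fin ler_pdivrMr//.
have [_ N_le] := covering_numberP (ball_coverable_interval d_gt0 Dl).
have [N0|N0] := posnP (covering_number D d).
  by rewrite N0 ln0// mulr_ge0//; lra.
have : ln (covering_number D d)%:R <= ln ((lambda + 1) / d).
  rewrite ler_ln ?posrE ?ltr0n ?divr_gt0//.
  apply: (@le_trans _ _ (Num.truncn (lambda / d)).+1%:R); first by rewrite ler_nat.
  rewrite -natr1 mulrDl lerD//; first by rewrite truncn_le divr_ge0// ltW.
  by rewrite mul1r invf_ge1// ltW.
move: ln_d; rewrite ltr_pdivrMr// ln_div ?posrE//; lra.
Unshelve. all: by end_near. Qed.

Lemma upper_box_dim_ge1 D D' (lambda : R) : D' `<=` D ->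
  (forall d, D d -> 0 <= d <= lambda) ->
  (forall eps : R, 0 < eps -> forall delta0, 0 < delta0 -> exists delta M,
    0 < delta < delta0 /\
    (1 - eps) * - ln delta <= ln (#|cells M delta D'|%:R / 3)) ->
  (1 <= upper_box_dim D)%E.
Proof.
move=> D'D Dl many; apply: le_ereal_inf_tmp => _ [U U0 <-].
apply/lee_addgt0Pr => eps eps0.
have /nbhs_ballP[e /= e0 eU] : nbhs (0 : R) [set y | 0 < y -> U y] by exact: U0.
have [d2 d20 lnd2] := neg_ln_gt (0 : R).
have ed0 : 0 < Num.min e d2 by rewrite lt_min e0.
have [d [M [/andP[d_gt0]]]] := many eps eps0 _ ed0.
rewrite lt_min => /andP[de dd2] card_ge.
have lnd0 := lnd2 d (introT andP (conj d_gt0 dd2)).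
have Ud : U d.
  by apply: (eU d _ d_gt0); rewrite -ball_normE /= sub0r normrN gtr0_norm.
rewrite -leeBlDr// le_ereal_sup_tmp//; eexists; first by exists d.
rewrite -EFinB lee_fin ler_pdivlMr//; apply: le_trans card_ge _.
have [cov _] := covering_numberP (ball_coverable_interval d_gt0 Dl).
have cov' : ball_coverable D' d (covering_number D d).
  by have [c Dc] := cov; exists c; exact: subset_trans D'D Dc.
have D'ge0 x : D' x -> 0 <= x by move=> /D'D /Dl /andP[].
have card_le := card_cells_le_coverable M d_gt0 D'ge0 cov'.
have [c0|c0] := posnP #|cells M d D'|.
  rewrite c0 mul0r ln0//; have [->|N0] := posnP (covering_number D d).
    by rewrite ln0.
  by rewrite ln_ge0// ler1n.
have N0 : (0 < covering_number D d)%N by move: (leq_trans c0 card_le); lia.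
rewrite ler_ln ?posrE ?divr_gt0 ?ltr0n// ler_pdivrMr ?ltr0n//.
by rewrite -natrM ler_nat.
Qed.

End covering_numbers.

Theorem theorem4p1 (R : realType) (s : R) (K : set (euclidean R 2))
  (hs : 1 <= s)
  (K_neq0 : K !=set0)
  (K_bounded : bounded_set K)
  (K_measurable : (hausdorff_measure s).-caratheodory K)
  (K_regular : AD_regular s K) :
  upper_box_dim (distance_set K) = 1%E.
Proof.
have [C C1 [_ HK _ regular]] := K_regular.
have [q q_dense] := plane_separable (R := R).
have [E [A [r0 [EK [y0 Ey0] A0 r00 spread]]]] :=
  AD_regular_evenly_spread hs C1 q_dense HK regular.
have [lambda Klambda] : exists lambda : R, forall x y, K x -> K y -> `|x - y| <= lambda.
  have [B [_ KB]] := K_bounded; exists ((B + 1) + (B + 1)) => x y Kx Ky.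
  by apply: le_trans (ler_normB _ _) _; rewrite lerD// KB// ltrDl.
have D_itv d : distance_set K d -> 0 <= d <= lambda.
  by move=> [x Kx [y Ky <-]]; rewrite normr_ge0 Klambda.
apply/eqP; rewrite eq_le; apply/andP; split.
  apply: upper_box_dim_le1 D_itv; exists 0, y0; first exact: EK.
  by exists y0; [exact: EK|rewrite subrr normr0].
have Elambda x y : E x -> E y -> `|x - y| <= lambda.
  by move=> Ex Ey; apply: Klambda; exact: EK.
apply: (@upper_box_dim_ge1 _ _ (distance_set E) lambda) => //.
  by move=> _ [x Ex [y Ey <-]]; exists x; [exact: EK|exists y; [exact: EK|]].
by move=> eps; exact: distance_set_many_cells spread A0 r00 Ey0 Elambda.
Qed.
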